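(* Let $\mathbb{B}=\{q\in\mathbb{H} : |q|<1\}$ and let $f:\mathbb{B}\to\mathbb{H}$ be a slice regular function such that $f(0)=0$ and $\partial_C f(0)=1$. Then there exists $u\in\mathbb{B}$ such that the image $\tilde f_u(B(0,1-|u|))$ of the regular translation $\tilde f_u$ of $f$ contains an open set obtained from $\mathcal{O}(\varrho)$ by means of a rotation and a translation (that is, a set of the form $A(\mathcal{O}(\varrho))+v$ with $A$ a rotation of $\mathbb{H}\cong\mathbb{R}^4$ about the origin and $v\in\mathbb{H}$), for some $\varrho\ge \frac{1}{32\sqrt{2}}$.
   Context: $\mathbb{H}$ is the skew field of quaternions, with real part $\operatorname{Re}(q)$ and modulus $|q|$; $\mathbb{S}=\{q\in\mathbb{H}: q^2=-1\}$; for $I\in\mathbb{S}$, $L_I=\mathbb{R}+\mathbb{R}I$; $B(0,R)=\{q\in\mathbb{H}:|q|<R\}$ and $B_I=B(0,R)\cap L_I$. A function $f:B(0,R)\to\mathbb{H}$ is slice regular (regular) if for every $I\in\mathbb{S}$ its restriction $f_I$ to $B_I$ has continuous partial derivatives and satisfies $\frac12\left(\frac{\partial}{\partial x}+I\frac{\partial}{\partial y}\right)f_I(x+yI)=0$ on $B_I$ (we then call $f_I$ holomorphic). Equivalently, $f(q)=\sum_{n\ge0}q^na_n$ is a convergent power series on $B(0,R)$ with coefficients $a_n\in\mathbb{H}$ on the right. The slice derivative is $\partial_C f(x+yI)=\frac{\partial}{\partial x}f(x+yI)$, i.e. $\partial_Cf(q)=\sum_{n\ge1}q^{n-1}na_n$.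 Regular translation: for $f$ regular on $B(0,R)$ and $w\in B(0,R)$, let $I\in\mathbb{S}$ with $w\in L_I$. The function $z\mapsto f(z+w)$ is holomorphic on $B(0,R-|w|)\cap L_I$; write it as $\sum_{n\ge0}z^nc_n$ with $c_n\in\mathbb{H}$. The regular translation $\tilde f_w:B(0,R-|w|)\to\mathbb{H}$ is its unique regular extension, $\tilde f_w(q)=\sum_{n\ge0}q^nc_n$. (If $w$ is real the choice of $I$ is irrelevant.) For $\varrho>0$, $\mathcal{O}(\varrho)=\{q\in\mathbb{H} : |q|^3<\varrho\,|\operatorname{Re}(q)|^2\}$. *)

(* Defs.v *)
From HB Require Import structures.
From mathcomp Require Import all_boot all_order all_algebra.
From mathcomp Require Import all_classical all_reals all_analysis.
From mathcomp Require Import ring.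

Set Implicit Arguments.
Unset Strict Implicit.
Unset Printing Implicit Defensive.

Import Order.TTheory GRing.Theory Num.Theory.
Import numFieldNormedType.Exports.

Local Open Scope classical_set_scope.
Local Open Scope ring_scope.

(* [a; b; c; d] stands for a + bi + cj + dk. The library's norm `|q| is the max
   norm inherited from 'rV[R]_4: it is used for its topology only, and the
   quaternionic modulus is [qmod] below. *)
Definition quat (R : realType) : Type := 'rV[R]_4.

HB.instance Definition _ (R : realType) := NormedModule.copy (quat R) 'rV[R]_4.
HB.instance Definition _ (R : realType) := Complete.copy (quat R) 'rV[R]_4.

Section QuatRing.
Variable R : realType.
Implicit Types p q : quat R.

Definition mkquat (a b c d : R) : quat R := \row_(i < 4) [:: a; b; c; d]`_i.

Definition qcomp q (k : nat) : R := (q : 'rV[R]_4) ord0 (inord k).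

Definition qone : quat R := mkquat 1 0 0 0.

Definition qmul p q : quat R :=
  mkquat
    (qcomp p 0 * qcomp q 0 - qcomp p 1 * qcomp q 1
     - qcomp p 2 * qcomp q 2 - qcomp p 3 * qcomp q 3)
    (qcomp p 0 * qcomp q 1 + qcomp p 1 * qcomp q 0
     + qcomp p 2 * qcomp q 3 - qcomp p 3 * qcomp q 2)
    (qcomp p 0 * qcomp q 2 - qcomp p 1 * qcomp q 3
     + qcomp p 2 * qcomp q 0 + qcomp p 3 * qcomp q 1)
    (qcomp p 0 * qcomp q 3 + qcomp p 1 * qcomp q 2
     - qcomp p 2 * qcomp q 1 + qcomp p 3 * qcomp q 0).

Lemma qcomp_mk a b c d :
  (qcomp (mkquat a b c d) 0 = a) * (qcomp (mkquat a b c d) 1 = b)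
  * (qcomp (mkquat a b c d) 2 = c) * (qcomp (mkquat a b c d) 3 = d).
Proof. by rewrite /qcomp !mxE !inordK. Qed.

Lemma qcompD p q k : qcomp (p + q) k = qcomp p k + qcomp q k.
Proof. by rewrite /qcomp mxE. Qed.

Lemma qcompZ a q k : qcomp (a *: q) k = a * qcomp q k.
Proof. by rewrite /qcomp mxE. Qed.

Lemma qcomp0 k : qcomp 0 k = 0.
Proof. by rewrite /qcomp mxE. Qed.

Lemma quatP p q :
  qcomp p 0 = qcomp q 0 -> qcomp p 1 = qcomp q 1 ->
  qcomp p 2 = qcomp q 2 -> qcomp p 3 = qcomp q 3 -> p = q.
Proof.
move=> h0 h1 h2 h3; apply/rowP => i; rewrite -[i]inord_val.
by case: i => -[|[|[|[|//]]]] ? /=.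
Qed.

Let qE := (qcompD, qcompZ, qcomp_mk, qcomp0).

Lemma qmulA : associative qmul.
Proof. by move=> p q r; apply: quatP; rewrite !qE; ring. Qed.

Lemma qmul1q : left_id qone qmul.
Proof. by move=> p; apply: quatP; rewrite !qE; ring. Qed.

Lemma qmulq1 : right_id qone qmul.
Proof. by move=> p; apply: quatP; rewrite !qE; ring. Qed.

Lemma qmulDl : left_distributive qmul +%R.
Proof. by move=> p q r; apply: quatP; rewrite !qE; ring. Qed.

Lemma qmulDr : right_distributive qmul +%R.
Proof. by move=> p q r; apply: quatP; rewrite !qE; ring. Qed.

Lemma qone_neq0 : qone != 0.
Proof.
by apply/eqP => /(congr1 (fun q => qcomp q 0)); rewrite !qE => /eqP; rewrite oner_eq0.
Qed.

HB.instance Definition _ := GRing.Zmodule_isNzRing.Build (quat R)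
  qmulA qmul1q qmulq1 qmulDl qmulDr qone_neq0.

Lemma qscaleAl (a : R) p q : a *: (p * q) = (a *: p) * q.
Proof. by apply: quatP; rewrite !qE; ring. Qed.

HB.instance Definition _ := GRing.Lmodule_isLalgebra.Build R (quat R) qscaleAl.

Lemma qscaleAr (a : R) p q : a *: (p * q) = p * (a *: q).
Proof. by apply: quatP; rewrite !qE; ring. Qed.

HB.instance Definition _ := GRing.Lalgebra_isAlgebra.Build R (quat R) qscaleAr.

End QuatRing.

Section SliceRegular.
Variable R : realType.
Implicit Types (I q w : quat R) (f g : quat R -> quat R) (r : R).

Definition qre q : R := qcomp q 0.

Definition qmod q : R := Num.sqrt (\sum_(k < 4) qcomp q k ^+ 2).

Definition qball r : set (quat R) := [set q | qmod q < r].

Definition unit_sphere : set (quat R) := [set q | q ^+ 2 = -1].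

Definition slice_pt I (p : R * R) : quat R := p.1%:A + p.2 *: I.

Definition slice I : set (quat R) := range (slice_pt I).

Definition slice_fun f I : R * R -> quat R := f \o slice_pt I.

(* Only the values of [f] on [qball r] matter. *)
Definition slice_regular r f : Prop :=
  forall I, unit_sphere I -> forall p : R * R, qball r (slice_pt I p) ->
  let fI := slice_fun f I in
  [/\ derivable fI p (1, 0), derivable fI p (0, 1),
      {for p, continuous ('D_(1, 0) fI)}, {for p, continuous ('D_(0, 1) fI)} &
      2^-1 *: ('D_(1, 0) fI p + I * 'D_(0, 1) fI p) = 0].

(* At q = x + yI this is the limit of h^-1 *: (f ((x + h) + yI) - f (x + yI)),
   i.e. the partial derivative of f in x, for whichever I has q in its slice. *)
Definition slice_derivative f q : quat R := 'D_(1 : quat R) f q.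

Definition qpower_sum (c : nat -> quat R) q (s : quat R) : Prop :=
  series (fun n => q ^+ n * c n) @ \oo --> s.

(* [g] is, on [qball (r - qmod w)], the regular translation at [w] of a function
   [f] that is slice regular on [qball r]. *)
Definition is_regular_translation r f w g : Prop :=
  exists I (c : nat -> quat R),
  [/\ unit_sphere I, slice I w,
      forall z, (qball (r - qmod w) `&` slice I) z ->
        qpower_sum c z (f (z + w)) &
      forall q, qball (r - qmod w) q -> qpower_sum c q (g q)].

Definition Oset (rho : R) : set (quat R) :=
  [set q | qmod q ^+ 3 < rho * `|qre q| ^+ 2].

Definition is_rotation (A : 'M[R]_4) : Prop := A *m A^T = 1%:M /\ \det A = 1.

Definition rotate (A : 'M[R]_4) q : quat R := (q : 'rV[R]_4) *m A.

End SliceRegular.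

(* Main.v *)
Require Import Defs.
From mathcomp Require Import all_boot all_order all_algebra.
From mathcomp Require Import all_classical all_reals all_analysis.
From mathcomp Require Import ring lra.

(* On the slice L of i, choose u nearly maximizing (r - |z|) |f'(z)| over the
   disc of radius r = 99/100 (Bloch's trick), and put s = r - |u|. Then f' is
   bounded by about 2 |f'(u)| on the disc of radius s/2 around u, so the
   coefficients c_n (n >= 1) of f at u satisfy |c_n| (s/2)^n <= C |c_1| s/2 with
   C close to 2, where c_1 = f'(u) and |c_1| s is at least about 1. Hence the
   regular translation q |-> sum q^n c_n differs on the ball of radius s/20 from
   q |-> c_0 + q c_1 by a map with Lipschitz constant |c_1|/2, and the
   contraction principle shows that its image contains a whole ball around c_0
   of radius |c_1| s/40 > 1/(32 sqrt 2). Since O(rho) is contained in the ball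
   of radius rho, the rotation can be taken to be the identity.

   The power series expansion on L is obtained without integrals: averages over
   the N-th roots of unity replace the Cauchy integral. With zeta_k running over
   the N points of a circle around the disc containing z, and P_k the N-term
   truncation of zeta_k / (zeta_k - z), the average of
   P_k F(z + t (zeta_k - z)) equals F(z) at t = 0 and a polynomial in z at
   t = 1, and its t-derivative tends to 0 as N grows because the increments of
   F around a circle telescope to 0. The coefficients of these polynomials
   converge along an ultrafilter, with uniform Cauchy bounds. *)

Set Implicit Arguments.
Unset Strict Implicit.
Unset Printing Implicit Defensive.

Import Order.TTheory GRing.Theory Num.Theory.
Import numFieldNormedType.Exports.

Local Open Scope classical_set_scope.
Local Open Scope ring_scope.

(** * The quaternionic modulus *)

Section Modulus.
Variable R : realType.
Implicit Types (p q z : quat R) (a e r : R).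

Lemma qcompN q k : qcomp (- q) k = - qcomp q k.
Proof. by rewrite /qcomp mxE. Qed.

Lemma qmulE p q : p * q = qmul p q. Proof. by []. Qed.

Lemma qone_mk : 1 = mkquat 1 0 0 0 :> quat R. Proof. by []. Qed.

Definition qE := (qcompD, qcompZ, qcompN, qmulE, qone_mk, qcomp_mk, qcomp0).

Definition qnorm2 q : R :=
  qcomp q 0 ^+ 2 + qcomp q 1 ^+ 2 + qcomp q 2 ^+ 2 + qcomp q 3 ^+ 2.

Lemma qnorm2_ge0 q : 0 <= qnorm2 q.
Proof. by rewrite /qnorm2 !addr_ge0 ?sqr_ge0. Qed.

Lemma qmodE q : qmod q = Num.sqrt (qnorm2 q).
Proof. by rewrite /qmod !big_ord_recr big_ord0 /= add0r. Qed.

Lemma qmod_ge0 q : 0 <= qmod q. Proof. exact: sqrtr_ge0. Qed.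

Lemma qmod_sqr q : qmod q ^+ 2 = qnorm2 q.
Proof. by rewrite qmodE sqr_sqrtr ?qnorm2_ge0. Qed.

Lemma qmod_le q a : 0 <= a -> (qmod q <= a) = (qnorm2 q <= a ^+ 2).
Proof. by move=> a0; rewrite -qmod_sqr ler_sqr ?nnegrE// qmod_ge0. Qed.

Lemma qmodM p q : qmod (p * q) = qmod p * qmod q.
Proof.
rewrite !qmodE -sqrtrM ?qnorm2_ge0//; congr Num.sqrt.
by rewrite /qnorm2 !qE; ring.
Qed.

Lemma qmod1 : qmod (1 : quat R) = 1.
Proof. by rewrite qmodE /qnorm2 !qE expr1n !expr0n /= !addr0 sqrtr1. Qed.

Lemma qmodX q n : qmod (q ^+ n) = qmod q ^+ n.
Proof. by elim: n => [|n ih]; rewrite ?expr0 ?qmod1// !exprS qmodM ih. Qed.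

Lemma qmodZ a q : qmod (a *: q) = `|a| * qmod q.
Proof.
rewrite !qmodE -sqrtr_sqr -sqrtrM ?sqr_ge0//; congr Num.sqrt.
by rewrite /qnorm2 !qE; ring.
Qed.

Lemma qmodN q : qmod (- q) = qmod q.
Proof. by rewrite -scaleN1r qmodZ normrN1 mul1r. Qed.

Lemma qmodB p q : qmod (p - q) = qmod (q - p).
Proof. by rewrite -qmodN opprB. Qed.

Lemma qmod0 : qmod (0 : quat R) = 0.
Proof. by rewrite -[0](scale0r (0 : quat R)) qmodZ normr0 mul0r. Qed.

(* Lagrange's identity gives the Cauchy-Schwarz inequality. *)
Lemma qmodD p q : qmod (p + q) <= qmod p + qmod q.
Proof.
rewrite qmod_le ?addr_ge0 ?qmod_ge0// sqrrD !qmod_sqr -mulr_natl.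
set d := qcomp p 0 * qcomp q 0 + qcomp p 1 * qcomp q 1
       + qcomp p 2 * qcomp q 2 + qcomp p 3 * qcomp q 3.
suff : d <= qmod p * qmod q by rewrite /qnorm2 /d !qE; nra.
apply: (le_trans (ler_norm _)).
rewrite -ler_sqr ?nnegrE ?mulr_ge0 ?qmod_ge0// exprMn !qmod_sqr real_normK ?num_real//.
rewrite -subr_ge0.
have -> : qnorm2 p * qnorm2 q - d ^+ 2 =
    (qcomp p 0 * qcomp q 1 - qcomp p 1 * qcomp q 0) ^+ 2
  + (qcomp p 0 * qcomp q 2 - qcomp p 2 * qcomp q 0) ^+ 2
  + (qcomp p 0 * qcomp q 3 - qcomp p 3 * qcomp q 0) ^+ 2
  + (qcomp p 1 * qcomp q 2 - qcomp p 2 * qcomp q 1) ^+ 2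
  + (qcomp p 1 * qcomp q 3 - qcomp p 3 * qcomp q 1) ^+ 2
  + (qcomp p 2 * qcomp q 3 - qcomp p 3 * qcomp q 2) ^+ 2.
  by rewrite /qnorm2 /d; ring.
by rewrite !addr_ge0 ?sqr_ge0.
Qed.

Lemma qmod_subD p q : qmod (p - q) <= qmod p + qmod q.
Proof. by rewrite (le_trans (qmodD _ _))// qmodN. Qed.

Lemma qmod_dist z p q : qmod (p - q) <= qmod (p - z) + qmod (z - q).
Proof. by rewrite (le_trans _ (qmodD _ _))// subrKA. Qed.

Lemma qmod_sum (I : Type) (s : seq I) (P : pred I) (F : I -> quat R) :
  qmod (\sum_(i <- s | P i) F i) <= \sum_(i <- s | P i) qmod (F i).
Proof.
elim/big_ind2: _ => [|x a y b ha hb|//]; first by rewrite qmod0.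
by rewrite (le_trans (qmodD _ _))// lerD.
Qed.

Lemma qmod_eq0 q : qmod q = 0 -> q = 0.
Proof.
move=> q0; have := qmod_sqr q; rewrite q0 expr0n /= /qnorm2 => h.
have hk x : 0 <= x ^+ 2 :> R by rewrite sqr_ge0.
have := (hk (qcomp q 0), hk (qcomp q 1), hk (qcomp q 2), hk (qcomp q 3)) => -[[[]]] ? ? ? ?.
by apply: quatP; rewrite qcomp0; apply/eqP; rewrite -sqrf_eq0; apply/eqP; lra.
Qed.

Lemma qmod_gt0 q : q != 0 -> 0 < qmod q.
Proof. by move=> q0; rewrite lt_neqAle qmod_ge0 andbT eq_sym; apply: contra_neq q0 => /qmod_eq0. Qed.

Lemma qmul_eq0 p q : p * q = 0 -> p != 0 -> q = 0.
Proof.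
move=> pq0 /qmod_gt0 p0; apply: qmod_eq0; apply/eqP.
have := qmodM p q; rewrite pq0 qmod0 => /esym/eqP.
by rewrite mulf_eq0 (gt_eqF p0).
Qed.

Lemma qcomp_le q k : `|qcomp q k| <= qmod q.
Proof.
rewrite -ler_sqr ?nnegrE ?qmod_ge0// qmod_sqr real_normK ?num_real// /qnorm2.
rewrite /qcomp; set i := inord k.
have hk x : 0 <= x ^+ 2 :> R by rewrite sqr_ge0.
have := (hk (qcomp q 0), hk (qcomp q 1), hk (qcomp q 2), hk (qcomp q 3)) => -[[[]]] ? ? ? ?.
rewrite -[i]inord_val -/(qcomp q i).
by case: i => -[|[|[|[|//]]]] ? /=; rewrite -!/(qcomp _ _); lra.
Qed.

Lemma qmod_le_qcomp q a : (forall k, `|qcomp q k| <= a) -> qmod q <= 2 * a.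
Proof.
move=> h; have a0 : 0 <= a := le_trans (normr_ge0 _) (h 0%N).
rewrite qmod_le ?mulr_ge0// /qnorm2.
have hk k : qcomp q k ^+ 2 <= a ^+ 2.
  by rewrite -[leLHS]real_normK ?num_real// ler_sqr ?nnegrE.
have := (hk 0%N, hk 1%N, hk 2%N, hk 3%N) => -[[[]]] ? ? ? ?.
by rewrite exprMn; lra.
Qed.

Lemma norm_le_qmod q : `|q| <= qmod q.
Proof.
rewrite [leLHS]/Num.Def.normr/= mx_normrE; apply: bigmax_le => [|[i j] _ /=]; first exact: qmod_ge0.
rewrite (ord1 i) -[j]inord_val; exact: qcomp_le.
Qed.

Lemma qmod_le_norm q : qmod q <= 2 * `|q|.
Proof.
apply: qmod_le_qcomp => k.
rewrite [leRHS]/Num.Def.normr/= mx_normrE.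
exact: (le_bigmax _ (fun ij => `|q ij.1 ij.2|) (ord0, inord k)).
Qed.

(** The topology of [quat R] comes from the max norm. By [norm_le_qmod] and [qmod_le_norm] the
    modulus is equivalent to it, so limits can be tested with [qmod]. *)
Lemma qcvgP (T : Type) (F : set_system T) {FF : Filter F} (u : T -> quat R) l :
  u x @[x --> F] --> l <-> forall e, 0 < e -> \forall x \near F, qmod (u x - l) < e.
Proof.
split=> [/cvgrPdist_lt h e e0|h].
  have := h (e / 2) (divr_gt0 e0 (ltr0n _ 2)); apply: filterS => x.
  by rewrite distrC ltr_pdivlMr// mulrC; apply: le_lt_trans; exact: qmod_le_norm.
apply/cvgrPdist_lt => e e0; apply: filterS (h e e0) => x.
by rewrite distrC; apply: le_lt_trans; exact: norm_le_qmod.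
Qed.

End Modulus.

(** * Power series with right coefficients *)

Section PowerSeries.
Variable R : realType.
Implicit Types (p q z s : quat R) (a e r M x t : R) (c d : nat -> quat R).

Lemma qcvg_dist_le (T : Type) (F : set_system T) {FF : ProperFilter F}
    (u : T -> quat R) l p a :
  u x @[x --> F] --> l -> (\forall x \near F, qmod (u x - p) <= a) ->
  qmod (l - p) <= a.
Proof.
move=> /qcvgP ul up; apply/ler_addgt0Pl => e e0.
have [x [h1 h2]] := filter_ex (filterI (ul e e0) up).
by rewrite (le_trans (qmod_dist (u x) _ _))// lerD// qmodB ltW.
Qed.

Lemma geometric_tail_le x m n : 0 <= x -> x < 1 ->
  \sum_(m <= k < n) x ^+ k <= x ^+ m / (1 - x).
Proof.
move=> x0 x1; have x1' : 0 < 1 - x by rewrite subr_gt0.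
have [mn|nm] := leqP m n; last first.
  by rewrite big_geq ?(ltnW nm)// divr_ge0 ?exprn_ge0// ltW.
rewrite ler_pdivlMr//; suff -> : (\sum_(m <= k < n) x ^+ k) * (1 - x) = x ^+ m - x ^+ n.
  by rewrite gerBl exprn_ge0.
rewrite mulr_suml; transitivity (\sum_(m <= k < n) (- x ^+ k.+1 - - x ^+ k)).
  by apply: eq_bigr => k _; rewrite exprS; ring.
by rewrite (telescope_sumr (fun k => - x ^+ k))// opprK addrC.
Qed.

(** The shape of Cauchy's estimates on the circle of radius [r]: the power series is dominated by a
    geometric one on the open ball. *)
Definition coef_bound c M r := forall n, qmod (c n) * r ^+ n <= M.

Lemma coef_bound_ge0 c M r : coef_bound c M r -> 0 <= M.
Proof. by move=> /(_ 0%N); rewrite expr0 mulr1; apply: le_trans; exact: qmod_ge0. Qed.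

Lemma pterm_le c M r z n : 0 < r -> coef_bound c M r ->
  qmod (z ^+ n * c n) <= M * (qmod z / r) ^+ n.
Proof.
move=> r0 /(_ n) h; rewrite qmodM qmodX expr_div_n.
rewrite mulrA ler_pdivlMr ?exprn_gt0// -mulrA mulrC.
by rewrite ler_wpM2r// exprn_ge0// qmod_ge0.
Qed.

Lemma psum_tail_le c M r z m n : 0 < r -> coef_bound c M r -> qmod z < r ->
  qmod (\sum_(m <= k < n) z ^+ k * c k)
  <= M * ((qmod z / r) ^+ m / (1 - qmod z / r)).
Proof.
move=> r0 cM zr; have M0 := coef_bound_ge0 cM.
apply: (le_trans (qmod_sum _ _ _)).
apply: (@le_trans _ _ (\sum_(m <= k < n) M * (qmod z / r) ^+ k)).
  by apply: ler_sum => k _; exact: pterm_le.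
rewrite -mulr_sumr ler_wpM2l// geometric_tail_le//.
  by rewrite divr_ge0 ?qmod_ge0// ltW.
by rewrite ltr_pdivrMr// mul1r.
Qed.

Lemma qseries_cvg (u : nat -> quat R) M x : 0 <= x -> x < 1 ->
  (forall n, qmod (u n) <= M * x ^+ n) -> exists s, series u @ \oo --> s.
Proof.
move=> x0 x1 h; exists (lim (series u @ \oo)).
apply: normed_cvg.
apply: (@series_le_cvg _ _ (geometric M x)) => [n|n|n|].
- exact: normr_ge0.
- by rewrite /geometric /= (le_trans _ (h n))// qmod_ge0.
- exact: le_trans (norm_le_qmod _) (h n).
- by apply: is_cvg_geometric_series; rewrite ger0_norm.
Qed.

Lemma pseries_cvg c M r z : 0 < r -> coef_bound c M r -> qmod z < r ->
  exists s, qpower_sum c z s.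
Proof.
move=> r0 cM zr; apply: (@qseries_cvg _ M (qmod z / r)).
- by rewrite divr_ge0 ?qmod_ge0// ltW.
- by rewrite ltr_pdivrMr// mul1r.
- by move=> n; exact: pterm_le.
Qed.

Lemma pseries_tail c M r z s m : 0 < r -> coef_bound c M r -> qmod z < r ->
  qpower_sum c z s ->
  qmod (s - \sum_(0 <= k < m) z ^+ k * c k)
  <= M * ((qmod z / r) ^+ m / (1 - qmod z / r)).
Proof.
move=> r0 cM zr cs; apply: (qcvg_dist_le cs).
near=> n; have mn : (m <= n)%N by near: n; exists m.
rewrite /series /= (big_cat_nat _ mn)//= addrAC subrr add0r.
exact: psum_tail_le.
Unshelve. all: by end_near. Qed.

Lemma small_mul_eq0 (a M b : R) : 0 <= a -> 0 < b ->
  (forall t, 0 < t -> t < b -> a <= M * t) -> a = 0.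
Proof.
move=> a0 b0 h; apply/eqP; rewrite eq_le a0 andbT leNgt; apply/negP => a1.
have M1 : 0 < `|M| + 1 by rewrite ltr_wpDl.
pose t := Num.min (b / 2) (a / (2 * (`|M| + 1))).
have t0 : 0 < t by rewrite lt_min !divr_gt0// mulr_gt0.
have tb : t < b by rewrite gt_min ltr_pdivrMr// ltr_pMr// ltr1n.
have /le_trans : a <= (`|M| + 1) * t.
  by rewrite (le_trans (h t t0 tb))// ler_wpM2r ?(ltW t0)// (le_trans (ler_norm _))// lerDl.
move=> /(_ (a / 2)); suff : (`|M| + 1) * t <= a / 2 by move=> h1 /(_ h1); lra.
have -> : a / 2 = (`|M| + 1) * (a / (2 * (`|M| + 1))) by field; rewrite gt_eqF.
by rewrite ler_wpM2l ?(ltW M1)// ge_min lexx orbT.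
Qed.

Lemma qmod_alg (t : R) : 0 <= t -> qmod (t%:A : quat R) = t.
Proof. by move=> t0; rewrite qmodZ qmod1 mulr1 ger0_norm. Qed.

(** Strong induction: once the lower coefficients vanish, the tail estimate at the real point
    [r * x] gives [qmod (c n) * r ^+ n <= 2 * M * x] for all small [x]. *)
Lemma pseries_coef_eq0 c M r : 0 < r -> coef_bound c M r ->
  (forall t, 0 < t -> t < r -> qpower_sum c t%:A 0) -> forall n, c n = 0.
Proof.
move=> r0 cM c0; have M0 := coef_bound_ge0 cM.
elim/ltn_ind => n ih.
apply: qmod_eq0; apply: (mulIf (lt0r_neq0 (exprn_gt0 n r0))); rewrite mul0r.
apply: (@small_mul_eq0 _ (2 * M) 2^-1); rewrite ?mulr_ge0 ?qmod_ge0 ?exprn_ge0 ?invr_gt0 ?(ltW r0)//.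
move=> x x0 x2.
have x1 : x < 1 by apply: (lt_trans x2); rewrite invf_lt1 ?ltr1n.
have rx : r * x < r by rewrite gtr_pMr.
have := pseries_tail n.+1 r0 cM _ (c0 _ (mulr_gt0 r0 x0) rx).
rewrite qmod_alg ?mulr_ge0 ?(ltW r0) ?(ltW x0)// => /(_ rx).
rewrite big_nat_recr//= big_nat big1 => [|k /andP[_ kn]]; last by rewrite ih// mulr0.
rewrite !add0r qmodN qmodM qmodX qmod_alg ?mulr_ge0 ?(ltW r0) ?(ltW x0)//.
rewrite [r * x]mulrC mulfK ?gt_eqF// => h.
have xn : 0 < x ^+ n by rewrite exprn_gt0.
rewrite -(ler_pM2l xn); apply: (le_trans (_ : _ <= (x * r) ^+ n * qmod (c n))).
  by rewrite exprMn; lra.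
apply: (le_trans h); rewrite exprS.
have -> : x ^+ n * (2 * M * x) = M * (x * x ^+ n * 2) by ring.
rewrite ler_wpM2l// ler_wpM2l ?mulr_ge0 ?(ltW x0) ?(ltW xn)//.
rewrite -[leRHS]invrK lef_pV2 ?posrE ?invr_gt0 ?subr_gt0//.
lra.
Qed.

Lemma qpower_sumB c d z p q :
  qpower_sum c z p -> qpower_sum d z q ->
  qpower_sum (fun n => c n - d n) z (p - q).
Proof.
move=> cp dq; rewrite /qpower_sum.
have -> : series (fun n => z ^+ n * (c n - d n)) =
    series (fun n => z ^+ n * c n) \- series (fun n => z ^+ n * d n).
  apply/funext => n; rewrite /series /= -sumrB.
  by apply: eq_bigr => k _; rewrite mulrBr.
exact: cvgB cp dq.
Qed.

Lemma coef_bound_le c M r r' : 0 <= r' -> r' <= r -> coef_bound c M r -> coef_bound c M r'.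
Proof.
move=> r0 rr cM n; rewrite (le_trans _ (cM n))// ler_wpM2l ?qmod_ge0//.
by apply: lerXn2r; rewrite ?nnegrE ?(le_trans r0).
Qed.

Lemma pseries_coef_uniq c d M M' r (F : quat R -> quat R) : 0 < r ->
  coef_bound c M r -> coef_bound d M' r ->
  (forall t, 0 < t -> t < r -> qpower_sum c t%:A (F t%:A)) ->
  (forall t, 0 < t -> t < r -> qpower_sum d t%:A (F t%:A)) ->
  c =1 d.
Proof.
move=> r0 cM dM cF dF n; apply/eqP; rewrite -subr_eq0; apply/eqP.
apply: (@pseries_coef_eq0 (fun n => c n - d n) (M + M') r) => //.
  move=> k; have h := qmod_subD (c k) (d k).
  apply: (le_trans (_ : _ <= (qmod (c k) + qmod (d k)) * r ^+ k)).
    by rewrite ler_wpM2r// exprn_ge0// ltW.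
  by rewrite mulrDl lerD.
by move=> t t0 tr; rewrite -(subrr (F t%:A)); apply: qpower_sumB; [exact: cF|exact: dF].
Qed.

End PowerSeries.

(** * Covering by power series close to their linear part *)

Section Covering.
Variable R : realType.
Implicit Types (p q z s y b : quat R) (a e r M x t : R) (c d : nat -> quat R).

(** Banach iteration from 0. The map contracts only on the ball of radius [a], and the bound on
    [T 0] keeps every iterate inside it. *)
Lemma half_contraction_fixpoint (T : quat R -> quat R) a :
  (forall p q, qmod p <= a -> qmod q <= a -> qmod (T p - T q) <= qmod (p - q) / 2) ->
  qmod (T 0) <= a / 2 -> exists2 q, qmod q <= a & T q = q.
Proof.
move=> hT hT0.
have a0 : 0 <= a by have := qmod_ge0 (T 0); lra.
pose u n := iter n T 0.
have ua n : qmod (u n) <= a.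
  elim: n => [|n ih]; first by rewrite /u /= qmod0.
  have := hT _ _ ih (_ : qmod 0 <= a); rewrite qmod0 => /(_ a0).
  rewrite subr0 -[T (u n)]/(u n.+1) => h1.
  have := qmodD (u n.+1 - T 0) (T 0); rewrite subrK; lra.
(* The iterates are the partial sums of their increments [v], so a geometric bound on [v] yields
   convergence. *)
pose v n := u n.+1 - u n.
have vb n : qmod (v n) <= a / 2 * 2^-1 ^+ n.
  elim: n => [|n ih]; first by rewrite /v /u /= subr0 expr0 mulr1.
  rewrite exprSr mulrA (le_trans (hT _ _ (ua n.+1) (ua n)))//.
  by rewrite ler_wpM2r.
have [||q] := qseries_cvg _ _ vb; [by []|by rewrite invf_lt1 ?ltr1n|].
have -> : series v = u.
  by apply/funext => n; rewrite /series /= telescope_sumr// subr0.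
move=> uq; have qa : qmod q <= a.
  rewrite -[q]subr0; apply: (qcvg_dist_le uq); near=> n; rewrite subr0; exact: ua.
exists q => //; apply/eqP; rewrite -subr_eq0; apply/eqP/qmod_eq0.
apply/eqP; rewrite eq_le qmod_ge0 andbT; apply/ler_addgt0Pl => e e0; rewrite addr0.
have /qcvgP/(_ (e / 3) (divr_gt0 e0 (ltr0n _ 3)))[n _ hn] := uq.
have h1 := hn n (leqnn n); have h2 := hn n.+1 (leqnSn n).
have h3 := hT _ _ qa (ua n).
have := qmod_dist (u n.+1) (T q) q; rewrite [qmod (q - u n)]qmodB in h3.
rewrite -[T (u n)]/(u n.+1) in h3; rewrite /= in h1 h2; lra.
Unshelve. all: by end_near. Qed.

(** The splitting used in the induction keeps the order of the factors, as [p] and [q] need not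
    commute. *)
Lemma qmod_subXX p q a n : qmod p <= a -> qmod q <= a ->
  qmod (q ^+ n.+1 - p ^+ n.+1) <= n.+1%:R * a ^+ n * qmod (q - p).
Proof.
move=> pa qa; have a0 := le_trans (qmod_ge0 p) pa.
elim: n => [|n ih]; first by rewrite !expr1 expr0 !mul1r.
have -> : q ^+ n.+2 - p ^+ n.+2 = q * (q ^+ n.+1 - p ^+ n.+1) + (q - p) * p ^+ n.+1.
  by rewrite mulrBr mulrBl -!exprS subrKA.
rewrite (le_trans (qmodD _ _))// !qmodM qmodX.
apply: (le_trans (_ : _ <= a * (n.+1%:R * a ^+ n * qmod (q - p)) + qmod (q - p) * a ^+ n.+1)).
  apply: lerD; first by apply: ler_pM; rewrite ?qmod_ge0.
  by rewrite ler_wpM2l ?qmod_ge0// lerXn2r ?nnegrE ?qmod_ge0.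
by rewrite -[n.+2]addn1 natrD exprS le_eqVlt; apply/orP; left; apply/eqP; ring.
Qed.

(** The full series is 1/(1 - x)^2 - 1 = 19/81 at x = 1/10. Adding the exact remainder turns the
    bound into an identity that induction proves. *)
Lemma sum_derivative_geometric_le (n : nat) :
  \sum_(1 <= k < n.+1) k.+1%:R * 10^-1 ^+ k <= 19 / 81 :> R.
Proof.
suff <- : \sum_(1 <= k < n.+1) k.+1%:R * 10^-1 ^+ k + (9 * n%:R + 19) / 81 * 10^-1 ^+ n
    = 19 / 81 :> R.
  by rewrite lerDl !mulr_ge0 ?exprn_ge0 ?addr_ge0 ?mulr_ge0.
elim: n => [|n ih]; first by rewrite big_geq// expr0; lra.
rewrite big_nat_recr//= -[RHS]ih exprS -!natr1.
by field.
Qed.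

Lemma qinv_exists p : p != 0 -> exists b, [/\ b * p = 1, p * b = 1 & qmod b = (qmod p)^-1].
Proof.
move=> p0; have np0 : qnorm2 p != 0 by rewrite -qmod_sqr sqrf_eq0 gt_eqF// qmod_gt0.
pose b := (qnorm2 p)^-1 *: mkquat (qcomp p 0) (- qcomp p 1) (- qcomp p 2) (- qcomp p 3).
have bp : b * p = 1.
  by apply: quatP; rewrite /b !qE; move: np0; rewrite /qnorm2 => np0; field.
exists b; split=> //.
  by apply: quatP; rewrite /b !qE; move: np0; rewrite /qnorm2 => np0; field.
have := qmodM b p; rewrite bp qmod1 => h.
by apply: (mulIf (lt0r_neq0 (qmod_gt0 p0))); rewrite -h mulVf// gt_eqF// qmod_gt0.
Qed.

(** On the ball of radius [r / 10] the terms of degree at least 2 have total Lipschitz constant at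
    most 41/20 * 19/81 times [qmod (c 1)], and 41/20 * 19/81 < 1/2. *)
Lemma pseries_near_linear c r p q s (t : quat R) : 0 < r ->
  (forall n, qmod (c n.+1) * r ^+ n.+1 <= 41 / 20 * (qmod (c 1%N) * r)) ->
  qmod p <= r / 10 -> qmod q <= r / 10 ->
  qpower_sum c p s -> qpower_sum c q t ->
  qmod (t - s - (q - p) * c 1%N) <= qmod (c 1%N) / 2 * qmod (q - p).
Proof.
move=> r0 cb pr qr ps qt.
have tsB : (series (fun n => q ^+ n * c n) n - series (fun n => p ^+ n * c n) n)
    @[n --> \oo] --> t - s by exact: cvgB qt ps.
apply: (qcvg_dist_le tsB); exists 2%N => // -[|[|n]]// _.
rewrite /series /= -sumrB.
under eq_bigr do rewrite -mulrBl.
rewrite big_ltn// expr0 subrr mul0r add0r big_ltn// !expr1 addrAC subrr add0r.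
rewrite big_add1 /=; apply: (le_trans (qmod_sum _ _ _)).
have hk k : (1 <= k < n.+1)%N -> qmod ((q ^+ k.+1 - p ^+ k.+1) * c k.+1)
    <= (k.+1%:R * 10^-1 ^+ k) * (41 / 20 * qmod (c 1%N) * qmod (q - p)).
  move=> _; rewrite qmodM.
  have rk : 0 < r ^+ k.+1 by rewrite exprn_gt0.
  have -> : qmod (c k.+1) = qmod (c k.+1) * r ^+ k.+1 / r ^+ k.+1 by rewrite mulfK// gt_eqF.
  apply: (le_trans (_ : _ <= (k.+1%:R * (r / 10) ^+ k * qmod (q - p))
     * (41 / 20 * (qmod (c 1%N) * r) / r ^+ k.+1))).
    apply: ler_pM; rewrite ?qmod_ge0 ?mulr_ge0 ?qmod_ge0 ?invr_ge0 ?(ltW rk)//.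
      exact: qmod_subXX.
    by rewrite ler_wpM2r// invr_ge0 ltW.
  rewrite exprMn exprS le_eqVlt; apply/orP; left; apply/eqP; field.
  by rewrite !gt_eqF ?exprn_gt0.
rewrite big_nat; apply: (le_trans (ler_sum _ hk)).
rewrite -big_nat -mulr_suml; apply: (le_trans (ler_wpM2r _ (sum_derivative_geometric_le n))).
  by rewrite !mulr_ge0 ?qmod_ge0.
have := mulr_ge0 (qmod_ge0 (c 1%N)) (qmod_ge0 (q - p)).
move: (qmod _) (qmod _) => A D; lra.
Qed.

(** In a difference of two Newton steps the linear part cancels, and only the deviation of the
    series from it survives. *)
Lemma newton_step_sub (p q s t e y d b : quat R) : d * b = 1 ->
  p - (s - e - y) * b - (q - (t - e - y) * b) = - ((s - t - (p - q) * d) * b).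
Proof.
move=> db; rewrite [in RHS]mulrBl -[(p - q) * d * b]mulrA db mulr1.
by apply: quatP; rewrite !qE; ring.
Qed.

Lemma pseries_covering c r y : 0 < r -> c 1%N != 0 ->
  (forall n, qmod (c n.+1) * r ^+ n.+1 <= 41 / 20 * (qmod (c 1%N) * r)) ->
  qmod y <= qmod (c 1%N) * r / 20 ->
  exists2 q, qmod q <= r / 10 & qpower_sum c q (c 0%N + y).
Proof.
move=> r0 c10 cb yb; have A0 := qmod_gt0 c10.
have [b [bc cb1 qb]] := qinv_exists c10.
pose M := qmod (c 0%N) + 41 / 20 * (qmod (c 1%N) * r).
have cM : coef_bound c M r.
  move=> [|n]; rewrite /M ?expr0 ?mulr1 ?lerDl ?mulr_ge0 ?(ltW r0) ?(ltW A0)//.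
  by rewrite (le_trans (cb n))// lerDr qmod_ge0.
(* [S] is the sum of the series on the ball of radius [r / 10], with default value 0 outside. *)
have /choice[S hS] : forall q, exists s, qmod q <= r / 10 -> qpower_sum c q s.
  move=> q; have [qr|qr] := leP (qmod q) (r / 10); last by exists 0.
  have [|s cs] := @pseries_cvg _ c M r q r0 cM; last by exists s.
  by apply: (le_lt_trans qr); lra.
(* Simplified Newton map with the fixed slope [c 1]; its fixed points solve [S q = c 0 + y]. Since
   [T 0 = y * b], the bound on [y] gives [qmod (T 0) <= r / 20], half the radius of the ball. *)
pose T q := q - (S q - c 0%N - y) * b.
have TE p q : qmod p <= r / 10 -> qmod q <= r / 10 -> qmod (T p - T q) <= qmod (p - q) / 2.
  move=> pr qr.
  have -> : T p - T q = - ((S p - S q - (p - q) * c 1%N) * b).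
    exact: (newton_step_sub p q (S p) (S q) (c 0%N) y cb1).
  rewrite qmodN qmodM qb.
  have := pseries_near_linear r0 cb qr pr (hS _ qr) (hS _ pr).
  by rewrite ler_pdivrMr// [qmod (p - q) / 2 * _]mulrC mulrA mulrAC.
have S0 : S 0 = c 0%N.
  have := pseries_tail 1%N r0 cM _ (hS 0 _); rewrite qmod0 => /(_ r0 (divr_ge0 (ltW r0) (ler0n _ 10))).
  rewrite big_nat1 expr0 mul1r mul0r expr1 mul0r mulr0 => h.
  by apply/eqP; rewrite -subr_eq0; apply/eqP/qmod_eq0/eqP; rewrite eq_le h qmod_ge0.
have [|q qr Tq] := half_contraction_fixpoint TE.
  rewrite /T S0 subrr !sub0r mulNr opprK qmodM qb ler_pdivrMr//; lra.
exists q => //; have -> : c 0%N + y = S q; last exact: hS.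
have : (S q - c 0%N - y) * b = 0.
  by have /eqP := Tq; rewrite /T subr_eq addrC -subr_eq subrr eq_sym => /eqP.
move=> /(congr1 (fun z => z * c 1%N)); rewrite -mulrA bc mulr1 mul0r => /eqP.
by rewrite subr_eq0 subr_eq addrC => /eqP ->.
Qed.

End Covering.

(** * The slice of i and roots of unity *)

Section UnitCircle.
Variable R : realType.
Implicit Types (p q z : quat R) (t : R).

(** The commutative copy of the complex plane in which the function theory below takes place;
    [slice_iP] identifies it with the slice of [imag_i]. *)
Definition in_slice q := qcomp q 2 = 0 /\ qcomp q 3 = 0.

Lemma in_sliceC p q : in_slice p -> in_slice q -> p * q = q * p.
Proof.
by move=> [p2 p3] [q2 q3]; apply: quatP; rewrite !qE p2 p3 q2 q3; ring.
Qed.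

Lemma in_sliceM p q : in_slice p -> in_slice q -> in_slice (p * q).
Proof. by move=> [p2 p3] [q2 q3]; split; rewrite !qE p2 p3 q2 q3; ring. Qed.

Lemma in_sliceD p q : in_slice p -> in_slice q -> in_slice (p + q).
Proof. by move=> [p2 p3] [q2 q3]; split; rewrite !qE ?p2 ?p3 ?q2 ?q3 addr0. Qed.

Lemma in_sliceZ t q : in_slice q -> in_slice (t *: q).
Proof. by move=> [q2 q3]; split; rewrite !qE ?q2 ?q3 mulr0. Qed.

Lemma in_sliceB p q : in_slice p -> in_slice q -> in_slice (p - q).
Proof. by move=> hp hq; rewrite -scaleN1r; apply/in_sliceD/in_sliceZ. Qed.

Lemma in_slice1 : in_slice (1 : quat R). Proof. by split; rewrite !qE. Qed.

Lemma in_slice0 : in_slice (0 : quat R). Proof. by split; rewrite !qE. Qed.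

Lemma in_sliceX q n : in_slice q -> in_slice (q ^+ n).
Proof. by move=> hq; elim: n => [|n ih]; rewrite ?expr0 ?exprS; [exact: in_slice1|exact: in_sliceM]. Qed.

Definition cis t : quat R := mkquat (cos t) (sin t) 0 0.

Lemma in_slice_cis t : in_slice (cis t). Proof. by split; rewrite !qE. Qed.

Lemma cis0 : cis 0 = 1. Proof. by rewrite /cis cos0 sin0. Qed.

Lemma cisD s t : cis (s + t) = cis s * cis t.
Proof. by apply: quatP; rewrite !qE ?cosD ?sinD; ring. Qed.

Lemma cisX t n : cis t ^+ n = cis (n%:R * t).
Proof.
elim: n => [|n ih]; first by rewrite mul0r cis0.
by rewrite exprS ih -cisD -natr1; congr cis; ring.
Qed.

Lemma qmod_cis t : qmod (cis t) = 1.
Proof.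
by rewrite qmodE /qnorm2 !qE !expr0n /= !addr0 cos2Dsin2 sqrtr1.
Qed.

Lemma cis_neq1 t : 0 < t -> t < 2 * pi -> cis t != 1.
Proof.
move=> t0 t2; apply/eqP => /(congr1 (fun q => qcomp q 0)); rewrite !qE.
(* By the half-angle formula cos t = 1 would force sin (t/2) = 0, but t/2 lies strictly between 0
   and pi. *)
have -> : t = (t / 2) + (t / 2) by lra.
rewrite cosD -!expr2 => h; have := cos2Dsin2 (t / 2).
have : 0 < sin (t / 2) by apply: sin_gt0_pi; apply/andP; split; lra.
by move=> s0; have := exprn_gt0 2 s0; lra.
Qed.

Lemma cis_near1 b : 0 < b -> exists N0, forall N, (N0 <= N)%N ->
  qmod (cis (2 * pi / N.+1%:R) - 1) < b.
Proof.
move=> b0; have b4 : 0 < b / 4 by rewrite divr_gt0.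
have /cvgrPdist_lt/(_ _ b4)[/= d1 d10 h1] := @continuous_cos R 0.
have /cvgrPdist_lt/(_ _ b4)[/= d2 d20 h2] := @continuous_sin R 0.
pose d := Num.min d1 d2; have d0 : 0 < d by rewrite lt_min d10.
have p0 : 0 < 2 * pi :> R by rewrite mulr_gt0 ?pi_gt0.
exists (Num.truncn (2 * pi / d)) => N hN.
set t := 2 * pi / _.
have td : `|0 - t| < d.
  rewrite sub0r normrN gtr0_norm ?divr_gt0// ltr_pdivrMr// [d * _]mulrC -ltr_pdivrMr//.
  have h3 := Num.Theory.truncnS_gt (2 * pi / d).
  by rewrite (lt_le_trans h3)// ler_nat.
have := h1 t (lt_le_trans td _); have := h2 t (lt_le_trans td _).
rewrite !ge_min !lexx orbT => /(_ isT) hs /(_ isT) hc.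
apply: (@le_lt_trans _ _ (2 * (b / 4))); last by lra.
have -> : cis t - 1 = mkquat (cos t - 1) (sin t) 0 0.
  by apply: quatP; rewrite !qE ?oppr0 ?addr0.
rewrite cos0 in hc; rewrite sin0 sub0r normrN in hs; rewrite distrC in hc.
apply: qmod_le_qcomp => k; rewrite /qcomp; move: (inord k) => j.
rewrite -[j]inord_val -/(qcomp (mkquat _ _ _ _) j).
by case: j => -[|[|[|[|//]]]] ? /=; rewrite !qE ?normr0; apply/ltW.
Qed.

Lemma sum_expr_root_eq0 q n : q ^+ n = 1 -> q != 1 -> \sum_(k < n) q ^+ k = 0.
Proof.
move=> qn q1; apply: (@qmul_eq0 _ (q - 1)); last by rewrite subr_eq0.
by rewrite -subrX1 qn subrr.
Qed.

End UnitCircle.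

(** * Discrete Cauchy formula *)

Section SliceCauchy.
Variable R : realType.
Implicit Types (p q z : quat R) (e r K b t s : R) (F G : quat R -> quat R).

(** The unit interval is cut into [m] equal steps shorter than [b], whose increments telescope. *)
Lemma locally_lipschitz_increment (phi : R -> quat R) K b : 0 < b ->
  (forall t s, 0 <= t -> 0 < s -> s < b -> t + s <= 1 ->
     qmod (phi (t + s) - phi t) <= K * s) ->
  qmod (phi 1 - phi 0) <= K.
Proof.
move=> b0 h; pose m := (Num.truncn b^-1).+1.
have m0 : 0 < m%:R :> R by rewrite ltr0n.
have mb : m%:R^-1 < b.
  by rewrite invf_plt ?posrE//; exact: Num.Theory.truncnS_gt.
have -> : phi 1 - phi 0 = \sum_(0 <= j < m) (phi (j.+1%:R / m%:R) - phi (j%:R / m%:R)).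
  by rewrite (telescope_sumr (fun j => phi (j%:R / m%:R)))// mul0r divff// gt_eqF.
apply: (le_trans (qmod_sum _ _ _)).
apply: (@le_trans _ _ (\sum_(0 <= j < m) K * m%:R^-1)); last first.
  by rewrite sumr_const_nat subn0 -[leLHS]mulr_natr divfK// gt_eqF.
rewrite !big_nat; apply: ler_sum => j /andP[_ jm].
rewrite -natr1 mulrDl mul1r; apply: h => //.
- by rewrite invr_gt0.
- by rewrite -{2}[m%:R^-1]mul1r -mulrDl natr1 ler_pdivrMr// mul1r ler_nat.
Qed.

(** Complex differentiability on a closed disc of the slice, with one [d] valid at all points. The
    increment multiplies [G] from the left, in accordance with coefficients on the right. *)
Definition unif_derivable F G r := forall e, 0 < e -> exists2 d, 0 < d &
  forall p q, in_slice p -> in_slice q -> qmod p <= r -> qmod q <= r ->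
  qmod (q - p) < d -> qmod (F q - F p - (q - p) * G p) <= e * qmod (q - p).

Lemma unif_derivable_shift F G r r' u : in_slice u -> r' + qmod u <= r ->
  unif_derivable F G r ->
  unif_derivable (fun z => F (z + u) - F u) (fun z => G (z + u)) r'.
Proof.
move=> uL rr h e e0; have [d d0 hd] := h e e0; exists d => // p q pL qL pr qr pq.
have hpq : q + u - (p + u) = q - p by rewrite opprD addrACA subrr addr0.
rewrite opprB addrA subrK -hpq; apply: hd; rewrite ?hpq//; try exact: in_sliceD.
- by rewrite (le_trans (qmodD _ _))// (le_trans _ rr)// lerD.
- by rewrite (le_trans (qmodD _ _))// (le_trans _ rr)// lerD.
Qed.

Lemma in_slice_segment p q t : in_slice p -> in_slice q -> in_slice (p + t *: (q - p)).
Proof. by move=> pL qL; apply: in_sliceD => //; apply/in_sliceZ/in_sliceB. Qed.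

Lemma qmod_segment p q t r : 0 <= t -> t <= 1 -> qmod p <= r -> qmod q <= r ->
  qmod (p + t *: (q - p)) <= r.
Proof.
move=> t0 t1 pr qr.
have -> : p + t *: (q - p) = (1 - t) *: p + t *: q by rewrite scalerBr scalerBl scale1r addrCA addrC.
rewrite (le_trans (qmodD _ _))// !qmodZ !ger0_norm ?subr_ge0//.
have := ler_wpM2l t0 qr; have : 0 <= 1 - t by rewrite subr_ge0.
by move=> /ler_wpM2l/(_ _ _ pr); lra.
Qed.

Lemma unif_derivable_lipschitz F G r M p q : unif_derivable F G r ->
  in_slice p -> in_slice q -> qmod p <= r -> qmod q <= r ->
  (forall z, in_slice z -> qmod z <= r -> qmod (G z) <= M) ->
  qmod (F q - F p) <= M * qmod (q - p).
Proof.
move=> FG pL qL pr qr GM.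
apply/ler_addgt0Pr => e e0.
(* Chosen so that [e' * qmod (q - p) <= e]; the added 1 covers the case [p = q]. *)
pose e' := e / (qmod (q - p) + 1).
have qp1 : 0 < qmod (q - p) + 1 by rewrite ltr_wpDl ?qmod_ge0.
have e'0 : 0 < e' by rewrite divr_gt0.
have [d d0 hd] := FG e' e'0.
pose phi t := F (p + t *: (q - p)).
have -> : F q - F p = phi 1 - phi 0.
  by rewrite /phi scale1r scale0r addr0 [p + _]addrC subrK.
apply: (@le_trans _ _ ((M + e') * qmod (q - p))); last first.
  rewrite mulrDl lerD2l /e' -mulrA ger_pMr// mulrC ler_pdivrMr// mul1r.
  by rewrite lerDl.
apply: (@locally_lipschitz_increment _ _ (d / (qmod (q - p) + 1))); first by rewrite divr_gt0.
move=> t s t0 s0; rewrite ltr_pdivlMr// => sd ts.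
have t1 : t <= 1 by rewrite (le_trans _ ts)// lerDl ltW.
have st : p + (t + s) *: (q - p) - (p + t *: (q - p)) = s *: (q - p).
  by rewrite opprD addrACA subrr add0r -scalerBl addrAC subrr add0r.
have := hd (p + t *: (q - p)) (p + (t + s) *: (q - p)).
rewrite st qmodZ gtr0_norm// => /(_ (in_slice_segment _ pL qL) (in_slice_segment _ pL qL)).
move=> /(_ (qmod_segment t0 t1 pr qr) (qmod_segment (addr_ge0 t0 (ltW s0)) ts pr qr)).
have -> : s * qmod (q - p) < d by apply: le_lt_trans sd; rewrite ler_wpM2l ?(ltW s0)// lerDl.
move=> /(_ isT) h.
have := GM _ (in_slice_segment t pL qL) (qmod_segment t0 t1 pr qr) => hG.
rewrite -[phi (t + s) - phi t](subrK (s *: (q - p) * G (p + t *: (q - p)))).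
apply: (le_trans (qmodD _ _)).
have -> : (M + e') * qmod (q - p) * s = e' * (s * qmod (q - p)) + s * qmod (q - p) * M by ring.
apply: lerD => //; rewrite qmodM qmodZ gtr0_norm// ler_wpM2l ?mulr_ge0 ?(ltW s0) ?qmod_ge0//.
Qed.

(** * Averages over the roots of unity on a circle *)

Section RootsOfUnity.
Variables (F G : quat R -> quat R) (r e d : R) (N : nat).
Hypotheses (r0 : 0 < r) (e0 : 0 < e) (N0 : (0 < N)%N).
Hypothesis FG : forall p q, in_slice p -> in_slice q ->
  qmod p <= r -> qmod q <= r -> qmod (q - p) < d ->
  qmod (F q - F p - (q - p) * G p) <= e * qmod (q - p).

Let w : quat R := cis (2 * pi / N.+1%:R).
Let wi : quat R := cis (- (2 * pi / N.+1%:R)).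
Hypothesis wd : r * qmod (w - 1) < d.

Let zeta k : quat R := r *: w ^+ k.

Let wL : in_slice w. Proof. exact: in_slice_cis. Qed.
Let zetaL k : in_slice (zeta k). Proof. exact/in_sliceZ/in_sliceX. Qed.
Let qmod_zeta k : qmod (zeta k) = r.
Proof. by rewrite qmodZ qmodX qmod_cis expr1n mulr1 gtr0_norm. Qed.

Let wN1 : w ^+ N.+1 = 1.
Proof.
rewrite cisX mulrC divfK ?gt_eqF ?ltr0n//.
by apply: quatP; rewrite !qE // mulr_natl (cos2pi, sin2pi).
Qed.

Let wXn_neq1 n : (0 < n)%N -> (n < N.+1)%N -> w ^+ n != 1.
Proof.
move=> n0 nN; rewrite cisX; have p0 : 0 < 2 * pi :> R by rewrite mulr_gt0 ?pi_gt0.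
apply: cis_neq1; first by rewrite mulr_gt0 ?divr_gt0 ?ltr0n.
by rewrite mulrA ltr_pdivrMr ?ltr0n// [n%:R * _]mulrC ltr_pM2l// ltr_nat.
Qed.

Let w_neq1 : w != 1. Proof. by rewrite -[w]expr1 wXn_neq1. Qed.

Let wiXn n k : wi ^+ n ^+ k * w ^+ n ^+ k = 1.
Proof.
rewrite -!exprM -exprMn_comm; last by apply: in_sliceC; exact: in_slice_cis.
by rewrite -cisD addrC subrr cis0 expr1n.
Qed.

Let sum_wi n : (0 < n)%N -> (n < N.+1)%N -> \sum_(k < N.+1) wi ^+ n ^+ k = 0.
Proof.
move=> n0 nN; apply: sum_expr_root_eq0.
  by have := wiXn n N.+1; rewrite -[w ^+ n ^+ _]exprM mulnC exprM wN1 expr1n mulr1.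
apply: contra_neq (wXn_neq1 n0 nN) => h.
by have := wiXn n 1; rewrite !expr1 h mul1r.
Qed.

Variable z : quat R.
Hypotheses (zL : in_slice z) (zr : qmod z < r).

Let pt t k := z + t *: (zeta k - z).

Let ptL t k : in_slice (pt t k). Proof. exact: in_slice_segment. Qed.
Let pt0 k : pt 0 k = z. Proof. by rewrite /pt scale0r addr0. Qed.
Let pt1 k : pt 1 k = zeta k. Proof. by rewrite /pt scale1r [z + _]addrC subrK. Qed.
Let ptN t : pt t N.+1 = pt t 0. Proof. by rewrite /pt /zeta wN1. Qed.
Let pt_le t k : 0 <= t -> t <= 1 -> qmod (pt t k) <= r.
Proof. by move=> t0 t1; apply: qmod_segment; rewrite ?qmod_zeta ?(ltW zr). Qed.

(* The increments of [F] around the circle telescope to zero, while each of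
   them is nearly a fixed multiple of the corresponding term of the sum. *)
Let circle_sum_le t : 0 <= t -> t <= 1 ->
  qmod (\sum_(k < N.+1) zeta k * G (pt t k)) <= N.+1%:R * (e * r).
Proof.
move=> t0 t1; have w1 : 0 < qmod (w - 1) by rewrite qmod_gt0// subr_eq0.
have ptB k : pt t k.+1 - pt t k = t *: ((w - 1) * zeta k).
  rewrite /pt opprD addrACA subrr add0r -scalerBr; congr (_ *: _).
  by rewrite opprB addrA subrK mulrBl mul1r /zeta -scalerAr -exprS.
have ptd k : qmod (pt t k.+1 - pt t k) = t * (qmod (w - 1) * r).
  by rewrite ptB qmodZ qmodM qmod_zeta ger0_norm.
(* At [t = 0] all points coincide with [z] and the sum of the roots of unity is zero. The
   telescoping argument multiplies by [t], hence requires [t > 0]. *)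
move: t0; rewrite le_eqVlt => /orP[/eqP t0|t0].
  have -> : \sum_(k < N.+1) zeta k * G (pt t k) = (\sum_(k < N.+1) zeta k) * G z.
    by rewrite mulr_suml; apply: eq_bigr => k _; rewrite -t0 pt0.
  rewrite /zeta -scaler_sumr sum_expr_root_eq0// scaler0 mul0r qmod0.
  by rewrite !mulr_ge0 ?(ltW e0) ?(ltW r0).
have tw : 0 < t * qmod (w - 1) by rewrite mulr_gt0.
rewrite -(ler_pM2l tw).
have -> : t * qmod (w - 1) * qmod (\sum_(k < N.+1) zeta k * G (pt t k))
    = qmod (\sum_(0 <= k < N.+1) (F (pt t k.+1) - F (pt t k) - (pt t k.+1 - pt t k) * G (pt t k))).
  rewrite sumrB (telescope_sumr (fun k => F (pt t k)))// ptN subrr sub0r qmodN.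
  rewrite -{1}[t]ger0_norm ?(ltW t0)// -mulrA -qmodM -qmodZ; congr qmod.
  rewrite big_mkord mulr_sumr scaler_sumr; apply: eq_bigr => k _.
  by rewrite ptB mulrA -[RHS]scalerAl.
apply: (le_trans (qmod_sum _ _ _)).
apply: (@le_trans _ _ (\sum_(0 <= k < N.+1) e * (t * (qmod (w - 1) * r)))).
  apply: ler_sum => k _; rewrite -(ptd k); apply: FG => //; try exact: pt_le (ltW t0) t1.
  rewrite ptd; apply: le_lt_trans wd; rewrite [r * _]mulrC ger_pMl//.
  by rewrite mulr_gt0.
rewrite sumr_const_nat subn0 -mulr_natl le_eqVlt; apply/orP; left; apply/eqP; ring.
Qed.

(** As [wi] is the inverse of [w], [a k] is z / zeta_k, and [P k] truncates the geometric series of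
    zeta_k / (zeta_k - z). *)
Let a k : quat R := r^-1 *: (z * wi ^+ k).
Let P k := \sum_(n < N.+1) a k ^+ n.
Let x := qmod z / r.

Let aXn k n : a k ^+ n = z ^+ n * (r ^- n *: wi ^+ n ^+ k).
Proof.
rewrite /a exprZn exprMn_comm; last by apply: in_sliceC => //; apply/in_sliceX/in_slice_cis.
by rewrite -scalerAr exprVn -!exprM mulnC.
Qed.

(** Geometric sum: the remainder [a k ^+ N.+1] equals (z/r)^(N+1) for every [k], because
    [w ^+ N.+1 = 1]. Being independent of [k], it factors out of the sum over the circle. *)
Let P_zeta k : P k * (zeta k - z) = (1 - r ^- N.+1 *: z ^+ N.+1) * zeta k.
Proof.
have -> : zeta k - z = (1 - a k) * zeta k.
  rewrite mulrBl mul1r /a /zeta -scalerAl -scalerAr scalerA mulVf ?gt_eqF// scale1r -mulrA.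
  by have := wiXn 1 k; rewrite !expr1 => ->; rewrite mulr1.
rewrite mulrA; congr (_ * _).
have aC : P k * (1 - a k) = (1 - a k) * P k.
  apply: commrB; first exact: commr1.
  by apply/commr_sym/commr_sum => n _; exact: commrX.
rewrite aC -opprB mulNr -subrX1 opprB aXn -scalerAr.
suff -> : wi ^+ N.+1 = 1 by rewrite expr1n mulr1.
by have := wiXn N.+1 1; rewrite !expr1 wN1 mulr1.
Qed.

Let P_le k : qmod (P k) <= (1 - x)^-1.
Proof.
apply: (le_trans (qmod_sum _ _ _)).
have x1 : x < 1 by rewrite ltr_pdivrMr// mul1r.
have x0 : 0 <= x by rewrite divr_ge0 ?qmod_ge0// ltW.
have := geometric_tail_le 0 N.+1 x0 x1; rewrite expr0 mul1r; apply: le_trans.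
rewrite big_mkord; apply: ler_sum => n _.
by rewrite qmodX qmodZ qmodM qmodX qmod_cis expr1n mulr1 gtr0_norm ?invr_gt0// mulrC.
Qed.

(** The unnormalized average along the homotopy that shrinks the circle to the point [z] as [t] goes
    from 1 to 0. *)
Let phi t := \sum_(k < N.+1) P k * F (pt t k).

(** Linearizing [F] at [pt t k] turns the increment into [s] times the circle sum, up to a factor of
    modulus at most 2, plus errors weighted by [P k]. These two parts give the terms 2 and
    [2 / (1 - x)]. *)
Let phi_increment t s : 0 <= t -> 0 < s -> s < d / (2 * r) -> t + s <= 1 ->
  qmod (phi (t + s) - phi t) <= N.+1%:R * (e * r * (2 + 2 / (1 - x))) * s.
Proof.
move=> t0 s0; rewrite ltr_pdivlMr ?mulr_gt0// => sd ts.
have t1 : t <= 1 by rewrite (le_trans _ ts)// lerDl ltW.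
have x1 : x < 1 by rewrite ltr_pdivrMr// mul1r.
have x0 : 0 <= x by rewrite divr_ge0 ?qmod_ge0// ltW.
have ptB k : pt (t + s) k - pt t k = s *: (zeta k - z).
  by rewrite /pt opprD addrACA subrr add0r -scalerBl addrAC subrr add0r.
have zz k : qmod (zeta k - z) <= 2 * r.
  by rewrite (le_trans (qmod_subD _ _))// qmod_zeta mulr_natl mulr2n lerD2l ltW.
pose E k := F (pt (t + s) k) - F (pt t k) - (pt (t + s) k - pt t k) * G (pt t k).
have E_le k : qmod (E k) <= e * (s * (2 * r)).
  apply: (@le_trans _ _ (e * qmod (pt (t + s) k - pt t k))).
    apply: FG => //; try apply: pt_le; rewrite ?addr_ge0 ?(ltW s0)//.
    rewrite ptB qmodZ gtr0_norm//; apply: le_lt_trans sd.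
    by rewrite ler_wpM2l ?zz// ltW.
  by rewrite ler_wpM2l ?(ltW e0)// ptB qmodZ gtr0_norm// ler_wpM2l ?zz// ltW.
have -> : phi (t + s) - phi t = s *: ((1 - r ^- N.+1 *: z ^+ N.+1)
     * \sum_(k < N.+1) zeta k * G (pt t k)) + \sum_(k < N.+1) P k * E k.
  rewrite /phi mulr_sumr scaler_sumr -sumrB -big_split; apply: eq_bigr => k _ /=.
  rewrite -mulrBr mulrA -P_zeta /E ptB -mulrA scalerAr -mulrDr; congr (_ * _).
  by rewrite -[s *: (zeta k - z) * _]scalerAl [RHS]addrC subrK.
apply: (le_trans (qmodD _ _)).
have b2 : qmod (1 - r ^- N.+1 *: z ^+ N.+1) <= 2.
  rewrite (le_trans (qmod_subD _ _))// qmod1 qmodZ qmodX ger0_norm ?invr_ge0 ?exprn_ge0 ?(ltW r0)//.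
  by rewrite -[2]/(1 + 1) lerD2l mulrC -expr_div_n -/x exprn_ile1// ltW.
have -> : N.+1%:R * (e * r * (2 + 2 / (1 - x))) * s =
   s * (2 * (N.+1%:R * (e * r))) + N.+1%:R * ((1 - x)^-1 * (e * (s * (2 * r)))) by ring.
apply: lerD.
  rewrite qmodZ gtr0_norm// ler_wpM2l ?(ltW s0)// qmodM.
  by apply: ler_pM; rewrite ?qmod_ge0// circle_sum_le.
apply: (le_trans (qmod_sum _ _ _)).
apply: (@le_trans _ _ (\sum_(k < N.+1) (1 - x)^-1 * (e * (s * (2 * r))))).
  by apply: ler_sum => k _; rewrite qmodM; apply: ler_pM; rewrite ?qmod_ge0.
by rewrite sumr_const card_ord -[leLHS]mulr_natl.
Qed.

(** Summing the powers [a k ^+ n] over [k] leaves only [n = 0], by orthogonality of the roots of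
    unity. *)
Let phi0 : phi 0 = N.+1%:R *: F z.
Proof.
rewrite /phi; have -> : \sum_(k < N.+1) P k * F (pt 0 k) = (\sum_(k < N.+1) P k) * F z.
  by rewrite mulr_suml; apply: eq_bigr => k _; rewrite pt0.
rewrite -[F z in RHS]mul1r [RHS]scalerAl; congr (_ * _).
rewrite exchange_big big_ord_recl /= [X in _ + X]big1 => [|n _].
  rewrite addr0 (eq_bigr (fun=> 1)); last by move=> k _; rewrite expr0.
  by rewrite sumr_const card_ord scaler_nat.
rewrite (eq_bigr (fun k : 'I_N.+1 => z ^+ (lift ord0 n) *
    (r ^- (lift ord0 n) *: wi ^+ (lift ord0 n) ^+ k))) => [|k _]; last exact: aXn.
by rewrite -mulr_sumr -scaler_sumr sum_wi ?scaler0 ?mulr0// lift0 ltnS.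
Qed.

(** The Riemann sum of Cauchy's integral for the [n]-th Taylor coefficient, [r ^- n *: wi ^+ n ^+ k]
    being zeta_k^(-n). *)
Definition dft_coef n : quat R :=
  N.+1%:R^-1 *: \sum_(k < N.+1) r ^- n *: (wi ^+ n ^+ k * F (zeta k)).

Let phi1 : phi 1 = N.+1%:R *: \sum_(0 <= n < N.+1) z ^+ n * dft_coef n.
Proof.
rewrite /phi big_mkord scaler_sumr.
rewrite (eq_bigr (fun k : 'I_N.+1 => \sum_(n < N.+1) z ^+ n * (r ^- n *: (wi ^+ n ^+ k * F (zeta k))))).
  rewrite exchange_big; apply: eq_bigr => n _ /=.
  by rewrite -mulr_sumr /dft_coef -scalerAr scalerA divff ?scale1r// pnatr_eq0.
move=> k _; rewrite pt1 mulr_suml; apply: eq_bigr => n _.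
by rewrite aXn -mulrA -scalerAl.
Qed.

(** The factor [N.+1] in [phi 0], [phi 1] and the increment bound cancels, so the error does not
    grow with [N], which only has to make neighbouring points of the circle [d]-close. *)
Lemma dft_psum_approx : 0 < d ->
  qmod (F z - \sum_(0 <= n < N.+1) z ^+ n * dft_coef n)
  <= e * r * (2 + 2 / (1 - qmod z / r)).
Proof.
move=> d0; have N1 : 0 < N.+1%:R :> R by rewrite ltr0n.
rewrite -(ler_pM2l N1) -[X in X * qmod _](gtr0_norm N1) -qmodZ scalerBr -phi0 -phi1 qmodB.
apply: (@locally_lipschitz_increment _ _ (d / (2 * r))); first by rewrite divr_gt0// mulr_gt0.
exact: phi_increment.
Qed.

Lemma dft_coef_le M n : (forall q, in_slice q -> qmod q <= r -> qmod (F q) <= M) ->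
  qmod (dft_coef n) * r ^+ n <= M.
Proof.
move=> FM; have N1 : 0 < N.+1%:R :> R by rewrite ltr0n.
rewrite -ler_pdivlMr ?exprn_gt0// qmodZ gtr0_norm ?invr_gt0// mulrC ler_pdivrMr//.
apply: (le_trans (qmod_sum _ _ _)).
apply: (@le_trans _ _ (\sum_(k < N.+1) M / r ^+ n)); last first.
  by rewrite sumr_const card_ord -[leLHS]mulr_natr.
apply: ler_sum => k _; rewrite qmodZ qmodM !qmodX qmod_cis !expr1n mul1r.
rewrite ger0_norm ?invr_ge0 ?exprn_ge0 ?(ltW r0)// mulrC ler_wpM2r ?invr_ge0 ?exprn_ge0 ?(ltW r0)//.
by apply: FM; rewrite ?qmod_zeta.
Qed.

End RootsOfUnity.
End SliceCauchy.

(** * Power series expansion on the slice *)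

Section UltraLimit.
Variable R : realType.

(** Closed balls are compact and an ultrafilter converges to its cluster point. A single ultrafilter
    thus serves all coefficients at once, in place of a diagonal subsequence. *)
Lemma qmod_bounded_ultra_cvg (T : Type) (U : set_system T) (UU : UltraFilter U)
    (u : T -> quat R) a : (\forall x \near U, qmod (u x) <= a) ->
  exists2 l, u x @[x --> U] --> l & qmod l <= a.
Proof.
move=> ua.
pose A := [set q : 'rV[R]_4 | `|q| <= a].
have cA : compact A.
  apply: bounded_closed_compact.
    exists a; split=> [|b ab q /= qa]; first exact: num_real.
    exact: le_trans qa (ltW ab).
  apply: (@closed_comp _ _ (fun q : 'rV[R]_4 => `|q|) [set x : R | x <= a]) => [x _|].
    exact: norm_continuous.
  exact: closed_le.
have [|l [_ lU]] := cA (u x @[x --> U]) _.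
  by apply: filterS ua => x; apply: le_trans; exact: norm_le_qmod.
have ul : u x @[x --> U] --> (l : quat R).
  move=> V lV; have [//|UV] := in_ultra_setVsetC (u @^-1` V) UU.
  by have [q [/= nVq Vq]] := lU (~` V) V UV lV.
exists l => //; rewrite -[l]subr0; apply: (qcvg_dist_le ul).
by apply: filterS ua => x; rewrite subr0.
Qed.

End UltraLimit.

Section SliceExpansion.
Variable R : realType.
Implicit Types (p q z : quat R) (e r M t : R) (F G : quat R -> quat R) (c : nat -> quat R).

(** Exchanging the two points in the estimate with [e = 1] shows that [G] varies by at most 2 over
    distances below [d]; [m] such steps along a radius reach any point of the disc. *)
Lemma unif_derivable_bounded F G r : 0 <= r -> unif_derivable F G r ->
  exists M, forall q, in_slice q -> qmod q <= r -> qmod (G q) <= M.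
Proof.
move=> r0 /(_ 1 ltr01)[d d0 hd].
pose m := (Num.truncn (r / d)).+1.
have m0 : 0 < m%:R :> R by rewrite ltr0n.
have rm : r / m%:R < d.
  by rewrite ltr_pdivrMr// mulrC -ltr_pdivrMr//; exact: Num.Theory.truncnS_gt.
exists (qmod (G 0) + 2 * m%:R) => q qL qr.
have step p p' : in_slice p -> in_slice p' -> qmod p <= r -> qmod p' <= r ->
    qmod (p' - p) < d -> qmod (G p' - G p) <= 2.
  move=> pL pL' pr pr' pd; have [->|p'p] := eqVneq p' p; first by rewrite subrr qmod0.
  have p0 : 0 < qmod (p' - p) by rewrite qmod_gt0// subr_eq0.
  rewrite -(ler_pM2l p0) -qmodM.
  have -> : (p' - p) * (G p' - G p) = (F p' - F p - (p' - p) * G p) + (F p - F p' - (p - p') * G p').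
    by rewrite -[p - p']opprB mulNr opprK addrACA -[F p - F p']opprB subrr add0r addrC mulrBr.
  rewrite (le_trans (qmodD _ _))// [leRHS]mulrC mulr_natl mulr2n; apply: lerD.
    by have := hd _ _ pL pL' pr pr' pd; rewrite mul1r.
  by have := hd _ _ pL' pL pr' pr; rewrite qmodB mul1r; apply.
have h j : (j <= m)%N -> qmod (G ((j%:R / m%:R) *: q) - G 0) <= 2 * j%:R.
  elim: j => [|j ih] jm; first by rewrite mul0r scale0r subrr qmod0 mulr0.
  have lej i : (i <= m)%N -> qmod ((i%:R / m%:R) *: q) <= r.
    move=> im; rewrite qmodZ ger0_norm ?divr_ge0// (le_trans _ qr)// ler_piMl ?qmod_ge0//.
    by rewrite ler_pdivrMr// mul1r ler_nat.
  rewrite (le_trans (qmod_dist (G ((j%:R / m%:R) *: q)) _ _))// -natr1 mulrDr mulr1 [leRHS]addrC.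
  apply: lerD; last exact: ih (ltnW jm).
  apply: step; rewrite ?lej ?(ltnW jm)//; try exact: in_sliceZ; first by rewrite natr1 lej.
  rewrite -scalerBl -mulrBl addrAC subrr add0r mul1r qmodZ gtr0_norm ?invr_gt0//.
  by apply: le_lt_trans rm; rewrite mulrC ler_wpM2r// invr_ge0 ltW.
have := h m (leqnn m); rewrite divff ?gt_eqF// scale1r => h1.
by have := qmodD (G q - G 0) (G 0); rewrite subrK; lra.
Qed.

Lemma unif_derivable_fun_bounded F G r : 0 <= r -> unif_derivable F G r ->
  exists M, forall q, in_slice q -> qmod q <= r -> qmod (F q) <= M.
Proof.
move=> r0 FG; have [M GM] := unif_derivable_bounded r0 FG.
exists (M * r + qmod (F 0)) => q qL qr.
have M0 : 0 <= M by rewrite (le_trans _ (GM 0 _ _)) ?qmod_ge0 ?qmod0//; exact: in_slice0.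
have := unif_derivable_lipschitz FG (in_slice0 R) qL _ qr GM; rewrite qmod0 subr0 => /(_ r0) h.
have := qmodD (F q - F 0) (F 0); rewrite subrK => /le_trans; apply.
by rewrite lerD2r (le_trans h)// ler_wpM2l.
Qed.

Lemma slice_power_series F G r M : 0 < r -> unif_derivable F G r ->
  (forall q, in_slice q -> qmod q <= r -> qmod (F q) <= M) ->
  exists2 c, coef_bound c M r &
    forall z, in_slice z -> qmod z < r -> qpower_sum c z (F z).
Proof.
move=> r0 FG FM.
have [U [UU ooU]] := ultraFilterLemma (@eventually_filter : ProperFilter \oo).
have /choice[c hc] : forall n, exists l,
    dft_coef F r N n @[N --> U] --> l /\ qmod l <= M / r ^+ n.
  move=> n; have [|l ul lM] := qmod_bounded_ultra_cvg UU (u := fun N => dft_coef F r N n) (a := M / r ^+ n).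
    by apply: filterE => N; rewrite ler_pdivlMr ?exprn_gt0//; exact: dft_coef_le.
  by exists l.
have cM : coef_bound c M r by move=> n; rewrite -ler_pdivlMr ?exprn_gt0//; case: (hc n).
exists c => // z zL zr.
pose x := qmod z / r.
have x1 : x < 1 by rewrite ltr_pdivrMr// mul1r.
have x0 : 0 <= x by rewrite divr_ge0 ?qmod_ge0// ltW.
have M0 := coef_bound_ge0 cM.
(* For a fixed length [K], the partial sums converge along [U] coefficient by coefficient. *)
have psum_cvg K e : 0 < e -> \forall N \near U,
    qmod (\sum_(0 <= k < K) z ^+ k * dft_coef F r N k - \sum_(0 <= k < K) z ^+ k * c k) < e.
  elim: K e => [|K ih] e e0.
    by apply: filterE => N; rewrite !big_geq// subrr qmod0.
  have zK : 0 < qmod z ^+ K + 1 by rewrite ltr_wpDl ?exprn_ge0 ?qmod_ge0.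
  have [/qcvgP/(_ (e / 2 / (qmod z ^+ K + 1)))] := hc K.
  rewrite !divr_gt0// => /(_ isT) h2 _.
  apply: filterS2 (ih _ (divr_gt0 e0 (ltr0n _ 2))) h2 => N h1 h2.
  rewrite !big_nat_recr//= opprD addrACA -mulrBr (le_lt_trans (qmodD _ _))//.
  rewrite [ltRHS](_ : e = e / 2 + e / 2); last by lra.
  apply: ltr_leD => //; rewrite qmodM qmodX.
  move: h2; rewrite ltr_pdivlMr// => /ltW; apply: le_trans.
  by rewrite mulrC ler_wpM2l ?qmod_ge0// lerDl.
have approx e : 0 < e -> \forall N \near U,
    qmod (F z - \sum_(0 <= n < N.+1) z ^+ n * dft_coef F r N n) <= e.
  move=> e0; pose B := r * (2 + 2 / (1 - x)).
  have B0 : 0 < B by rewrite mulr_gt0// addr_gt0// divr_gt0// subr_gt0.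
  have [d d0 hd] := FG (e / B) (divr_gt0 e0 B0).
  have [N0 hN0] := cis_near1 (divr_gt0 d0 r0).
  apply: ooU; exists N0.+1 => // N /= NN.
  have -> : e = e / B * r * (2 + 2 / (1 - x)) by rewrite -mulrA divfK// gt_eqF.
  apply: (dft_psum_approx r0 (divr_gt0 e0 B0) _ hd) => //.
    exact: leq_ltn_trans NN.
  by rewrite mulrC -ltr_pdivlMr//; apply: hN0; exact: ltnW.
(* Order of choices: [K] first makes the tails small uniformly in [N], all [dft_coef] sharing the
   bound [M]; then [N] is picked in [U]. Three errors of size [e / 4] remain. *)
apply/qcvgP => e e0.
have [K0 _ hK0] : \forall K \near \oo, M * (x ^+ K / (1 - x)) < e / 4.
  have B0 : 0 < (M + 1) / (1 - x) by rewrite divr_gt0 ?subr_gt0// ltr_wpDl.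
  have /cvgrPdist_lt/(_ (e / 4 / ((M + 1) / (1 - x)))) : x ^+ n @[n --> \oo] --> 0.
    by apply: cvg_expr; rewrite ger0_norm.
  rewrite !divr_gt0 ?subr_gt0 ?ltr_wpDl// => /(_ isT); apply: filterS => K.
  rewrite sub0r normrN ger0_norm ?exprn_ge0// ltr_pdivlMr//; apply: le_lt_trans.
  rewrite mulrCA ler_wpM2l ?exprn_ge0// ler_wpM2r ?invr_ge0 ?subr_ge0 ?(ltW x1)//.
  by rewrite lerDl.
exists K0 => // K /hK0 tK /=.
have e4 : 0 < e / 4 by rewrite divr_gt0.
have UK : \forall N \near U, (K <= N.+1)%N by apply: ooU; exists K => // N /= /leqW.
have [N [[h1 h2] KN]] := filter_ex (filterI (filterI (psum_cvg K _ e4) (approx _ e4)) UK).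
have cdM : coef_bound (dft_coef F r N) M r by move=> n; exact: dft_coef_le.
have h3 := psum_tail_le K N.+1 r0 cdM zr.
rewrite (big_cat_nat _ KN)//= in h2; rewrite /series /=.
move: h1 h2 h3; rewrite -/x; set S := \sum_(0 <= k < K) _ * c k; set T := \sum_(K <= k < _) _.
set S' := \sum_(0 <= k < K) _ => h1 h2 h3.
have -> : S - F z = - (S' - S) + (- (F z - (S' + T)) - T).
  by rewrite [- (F z - _)]opprB [_ - F z - T]addrAC addrK opprB subrKA.
apply: (le_lt_trans (qmodD _ _)); rewrite qmodN.
have := qmod_subD (- (F z - (S' + T))) T; rewrite qmodN; lra.
Qed.

Lemma psum_at0 c M r s : 0 < r -> coef_bound c M r -> qpower_sum c 0 s -> c 0%N = s.
Proof.
move=> r0 cM cs; have := pseries_tail 1%N r0 cM _ cs; rewrite qmod0 => /(_ r0).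
rewrite big_nat1 expr0 mul1r mul0r expr1 mul0r mulr0 => h.
by apply/eqP; rewrite eq_sym -subr_eq0; apply/eqP/qmod_eq0/eqP; rewrite eq_le h qmod_ge0.
Qed.

Lemma unif_derivable_coef1 F G c M r : 0 < r -> unif_derivable F G r -> coef_bound c M r ->
  (forall z, in_slice z -> qmod z < r -> qpower_sum c z (F z)) -> c 1%N = G 0.
Proof.
move=> r0 FG cM cF; have M0 := coef_bound_ge0 cM.
have c0 : c 0%N = F 0 by apply: (psum_at0 r0 cM); apply: cF; rewrite ?qmod0//; exact: in_slice0.
apply/eqP; rewrite -subr_eq0; apply/eqP/qmod_eq0/eqP.
rewrite eq_le qmod_ge0 andbT; apply/ler_addgt0Pr => e e0; rewrite add0r.
have e2 : 0 < e / 2 by rewrite divr_gt0.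
have [d d0 hd] := FG _ e2.
pose B := 2 * M / r ^+ 2 + 1.
have B0 : 0 < B by rewrite ltr_wpDl// divr_ge0 ?mulr_ge0 ?exprn_ge0// ltW.
(* [t <= r / 2] bounds the tail beyond degree 1 by 2 M t^2 / r^2, [t < d] allows the derivative
   estimate, and [t * B <= e / 2] makes that tail at most [t * (e / 2)]. *)
pose t := Num.min (Num.min (r / 2) (d / 2)) (e / 2 / B).
have t0 : 0 < t by rewrite !lt_min !divr_gt0.
have tr : t <= r / 2 by rewrite !ge_min lexx.
have td : t < d by rewrite !gt_min [d / 2 < d](_ : _ = true) ?orbT//; apply/idP; lra.
have tB : t * B <= e / 2 by rewrite -ler_pdivlMr// !ge_min lexx orbT.
have tL : in_slice (t%:A : quat R) by exact/in_sliceZ/in_slice1.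
have tr' : t < r by lra.
have h1 := hd 0 t%:A (in_slice0 R) tL.
rewrite qmod0 subr0 qmod_alg ?(ltW t0)// in h1.
have {}h1 := h1 (ltW r0) (ltW tr') td.
have := pseries_tail 2%N r0 cM _ (cF t%:A tL _).
rewrite qmod_alg ?(ltW t0)// => /(_ tr' tr').
rewrite big_nat_recr//= big_nat1 expr0 mul1r expr1 c0 => h2.
have tt : t * qmod (c 1%N - G 0) = qmod (t%:A * c 1%N - t%:A * G 0).
  by rewrite -mulrBr qmodM qmod_alg// ltW.
have h3 : qmod (t%:A * c 1%N - t%:A * G 0) <= e / 2 * t + M * ((t / r) ^+ 2 / (1 - t / r)).
  have -> : t%:A * c 1%N - t%:A * G 0 = (F t%:A - F 0 - t%:A * G 0) - (F t%:A - (F 0 + t%:A * c 1%N)).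
    have key (x y u v : quat R) : v - u = (x - y - u) - (x - (y + v)).
      by apply: quatP; rewrite !qE; ring.
    exact: key.
  by rewrite (le_trans (qmod_subD _ _))// lerD.
rewrite -(ler_pM2l t0) tt (le_trans h3)// [leRHS](_ : _ = e / 2 * t + t * (e / 2)); last by lra.
rewrite lerD2l; apply: le_trans (ler_wpM2l (ltW t0) tB).
rewrite expr_div_n; have tr2 : t / r <= 2^-1 by rewrite ler_pdivrMr// mulrC.
have h4 : (1 - t / r)^-1 <= 2 by rewrite -[leRHS]invrK lef_pV2 ?posrE ?invr_gt0 ?subr_gt0//; lra.
apply: (@le_trans _ _ (M * (t ^+ 2 / r ^+ 2 * 2))).
  by rewrite ler_wpM2l// ler_wpM2l// divr_ge0 ?exprn_ge0// ltW.
have -> : M * (t ^+ 2 / r ^+ 2 * 2) = t * (t * (2 * M / r ^+ 2)) by ring.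
by rewrite ler_wpM2l ?(ltW t0)// ler_wpM2l ?(ltW t0)// lerDl.
Qed.

(** By uniqueness the expansions on all smaller discs share the coefficients found on radius
    [r / 2], which therefore inherit the Cauchy bound of each radius. *)
Lemma slice_power_series_ball F G r : 0 < r ->
  (forall s, 0 < s -> s < r -> unif_derivable F G s) ->
  exists c, [/\ c 1%N = G 0,
    forall s M, 0 < s -> s < r ->
      (forall q, in_slice q -> qmod q <= s -> qmod (F q) <= M) -> coef_bound c M s &
    forall z, in_slice z -> qmod z < r -> qpower_sum c z (F z)].
Proof.
move=> r0 FG.
have [r20 r2] : 0 < r / 2 /\ r / 2 < r by lra.
have [M FM] := unif_derivable_fun_bounded (ltW r20) (FG _ r20 r2).
have [c cM cF] := slice_power_series r20 (FG _ r20 r2) FM.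
have cE s M' d : 0 < s -> coef_bound d M' s ->
    (forall z, in_slice z -> qmod z < s -> qpower_sum d z (F z)) -> c =1 d.
  move=> s0 dM dF; pose t := Num.min (r / 2) s.
  have t0 : 0 < t by rewrite lt_min r20.
  apply: (@pseries_coef_uniq _ c d M M' t F) => //.
  - by apply: (coef_bound_le (ltW t0) _ cM); rewrite ge_min lexx.
  - by apply: (coef_bound_le (ltW t0) _ dM); rewrite ge_min lexx orbT.
  - move=> x x0; rewrite lt_min => /andP[xr xs].
    by apply: cF; rewrite ?qmod_alg ?(ltW x0)//; exact/in_sliceZ/in_slice1.
  - move=> x x0; rewrite lt_min => /andP[xr xs].
    by apply: dF; rewrite ?qmod_alg ?(ltW x0)//; exact/in_sliceZ/in_slice1.
exists c; split.
- exact: (unif_derivable_coef1 r20 (FG _ r20 r2) cM cF).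
- move=> s M' s0 sr FM'.
  have [d dM dF] := slice_power_series s0 (FG _ s0 sr) FM'.
  by move=> n; rewrite (cE _ _ _ s0 dM dF); exact: dM.
- move=> z zL zr; pose s := (qmod z + r) / 2.
  have zs : qmod z < s by rewrite /s; lra.
  have s0 : 0 < s by apply: le_lt_trans zs; exact: qmod_ge0.
  have sr : s < r by rewrite /s; lra.
  have [M' FM'] := unif_derivable_fun_bounded (ltW s0) (FG _ s0 sr).
  have [d dM dF] := slice_power_series s0 (FG _ s0 sr) FM'.
  have -> : c = d by apply/funext; exact: cE dM dF.
  exact: dF.
Qed.

End SliceExpansion.

(** * Uniform differentiability of slice regular functions *)

Section SliceRegularToUniform.
Variable R : realType.
Implicit Types (p q : quat R) (a b e r s t x y : R).

Lemma qcomp_cvg (T : Type) (F : set_system T) {FF : Filter F} (u : T -> quat R) l k :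
  u x @[x --> F] --> l -> qcomp (u x) k @[x --> F] --> qcomp l k.
Proof.
move=> /qcvgP ul; apply/cvgrPdist_lt => e e0; apply: filterS (ul e e0) => x.
by rewrite distrC -qcompN -qcompD; apply: le_lt_trans; exact: qcomp_le.
Qed.

(** The mean value theorem is applied to each real component; the factor 2 is the cost of returning
    from components to the modulus. *)
Lemma quat_increment_le (phi dphi : R -> quat R) (c : quat R) a b e : a <= b ->
  (forall t, a <= t <= b ->
     h^-1 *: (phi (h + t) - phi t) @[h --> 0^'] --> dphi t /\ qmod (dphi t - c) <= e) ->
  qmod (phi b - phi a - (b - a) *: c) <= 2 * (e * (b - a)).
Proof.
move=> ab hphi; apply: qmod_le_qcomp => k.
pose psi t := qcomp (phi t) k.
have dpsi t : a <= t <= b -> is_derive t 1 psi (qcomp (dphi t) k).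
  move=> /hphi[h0 _]; have h := qcomp_cvg (k := k) h0.
  have {}h : h^-1 *: ((psi \o shift t) (h *: 1) - psi t) @[h --> 0^'] --> qcomp (dphi t) k.
    have -> : (fun u : R => u^-1 *: ((psi \o shift t) (u *: 1) - psi t)) =
        (fun u => qcomp (u^-1 *: (phi (u + t) - phi t)) k); last exact: h.
    by apply/funext => u /=; rewrite qcompZ qcompD qcompN /psi [u *: 1]mulr1.
  by split; [exact: cvgP h|exact: cvg_lim h].
have [||t tab tE] := @MVT_segment R psi (fun t => qcomp (dphi t) k) a b ab.
- by move=> t; rewrite in_itv /= => /andP[/ltW ? /ltW ?]; apply: dpsi; apply/andP.
- apply: derivable_within_continuous => t; rewrite in_itv /= => tab.
  by have [] := dpsi t tab.
rewrite !qcompD !qcompN qcompZ -/(psi b) -/(psi a) tE mulrC -mulrBr normrM.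
rewrite ger0_norm ?subr_ge0// mulrC ler_wpM2r ?subr_ge0//.
rewrite -qcompN -qcompD (le_trans (qcomp_le _ _))//.
by move: tab; rewrite in_itv /= => /hphi[].
Qed.

Lemma quat_increment_le_sym (phi dphi : R -> quat R) (c : quat R) a b e :
  (forall t, `|t - a| <= `|b - a| ->
     h^-1 *: (phi (h + t) - phi t) @[h --> 0^'] --> dphi t /\ qmod (dphi t - c) <= e) ->
  qmod (phi b - phi a - (b - a) *: c) <= 2 * (e * `|b - a|).
Proof.
move=> hphi; have [ab|/ltW ba] := leP a b.
  rewrite ger0_norm ?subr_ge0//; apply: quat_increment_le => // t /andP[at_ tb].
  by apply: hphi; rewrite !ger0_norm ?subr_ge0// lerD2r.
have -> : phi b - phi a - (b - a) *: c = - (phi a - phi b - (a - b) *: c).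
  by rewrite [RHS]opprD [- (phi a - _)]opprB -[a - b]opprB scaleNr opprK.
rewrite qmodN ler0_norm ?subr_le0// opprB; apply: quat_increment_le => // t /andP[bt ta].
by apply: hphi; rewrite !ler0_norm ?subr_le0// !opprB lerD2l lerN2.
Qed.

Definition imag_i : quat R := mkquat 0 1 0 0.

Lemma unit_sphere_i : unit_sphere imag_i.
Proof. by rewrite /unit_sphere /= expr2; apply: quatP; rewrite !qE; ring. Qed.

Lemma slice_pt_i x y : slice_pt imag_i (x, y) = mkquat x y 0 0.
Proof. by rewrite /slice_pt; apply: quatP; rewrite !qE /=; ring. Qed.

Lemma in_sliceE q : in_slice q -> q = slice_pt imag_i (qcomp q 0, qcomp q 1).
Proof. by move=> [q2 q3]; rewrite slice_pt_i; apply: quatP; rewrite !qE. Qed.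

Lemma slice_iP q : slice imag_i q <-> in_slice q.
Proof.
split=> [[[x y] _ <-]|qL]; first by rewrite slice_pt_i; split; rewrite !qE.
by rewrite (in_sliceE qL); exists (qcomp q 0, qcomp q 1).
Qed.

Lemma qmod_i : qmod imag_i = 1.
Proof. by rewrite qmodE /qnorm2 !qE !expr0n expr1n /= !addr0 add0r sqrtr1. Qed.

Lemma continuous_qmod_slice_pt : continuous (fun p : R * R => qmod (slice_pt imag_i p)).
Proof.
move=> p; apply/cvgrPdist_lt => e e0.
have e2 : 0 < e / 2 by rewrite divr_gt0.
apply: filterS (nbhsx_ballx p (e / 2) e2) => q [/= q1 q2]; rewrite /ball /= in q1 q2.
have h : qmod (slice_pt imag_i p - slice_pt imag_i q) < e.
  have -> : slice_pt imag_i p - slice_pt imag_i q = (p.1 - q.1)%:A + (p.2 - q.2) *: imag_i.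
    by case: p q {q1 q2} => [? ?] [? ?]; rewrite !slice_pt_i; apply: quatP; rewrite !qE /=; ring.
  by rewrite (le_lt_trans (qmodD _ _))// !qmodZ qmod1 qmod_i; lra.
have h1 := qmodD (slice_pt imag_i p - slice_pt imag_i q) (slice_pt imag_i q).
have h2 := qmodD (slice_pt imag_i q - slice_pt imag_i p) (slice_pt imag_i p).
rewrite subrK in h1; rewrite subrK [qmod (_ - _)]qmodB in h2.
by rewrite ltr_norml; apply/andP; split; lra.
Qed.

Lemma shift_x (h x y : R) : h *: (1, 0) + (x, y) = (h + x, y) :> R * R.
Proof. by apply: injective_projections => /=; [rewrite [h *: 1]mulr1|rewrite scaler0 add0r]. Qed.

Lemma shift_y (h x y : R) : h *: (0, 1) + (x, y) = (x, h + y) :> R * R.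
Proof. by apply: injective_projections => /=; [rewrite scaler0 add0r|rewrite [h *: 1]mulr1]. Qed.

Lemma qmod_dist_half (u v c : quat R) e :
  qmod (u - c) < e / 2 -> qmod (v - c) < e / 2 -> qmod (v - u) <= e.
Proof. by move=> uc vc; have := qmod_dist c v u; rewrite [qmod (c - u)]qmodB; lra. Qed.

Lemma split_increment a b (u v w i g : quat R) :
  w - u - (a%:A + b *: i) * g = (w - v - b *: (i * g)) + (v - u - a *: g).
Proof.
rewrite mulrDl -!scalerAl mul1r; move: (i * g) => c.
by apply: quatP; rewrite !qE; ring.
Qed.

Lemma mkquat0 : mkquat 0 0 0 0 = 0 :> quat R.
Proof. by apply: quatP; rewrite qcomp_mk qcomp0. Qed.

Lemma mkquat_real x : mkquat (x + 0) 0 0 0 = x *: 1 + 0 :> quat R.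
Proof. by apply: quatP; rewrite !qE; ring. Qed.

Section Regular.
Variable f : quat R -> quat R.
Hypothesis f_regular : slice_regular 1 f.

Let fi := slice_fun f imag_i.
Let D := 'D_(1, 0) fi.

Definition slice_partial_x q : quat R := 'D_(1, 0) (slice_fun f imag_i) (qcomp q 0, qcomp q 1).

Let derive_x x y : qmod (slice_pt imag_i (x, y)) < 1 ->
  h^-1 *: (fi (h + x, y) - fi (x, y)) @[h --> 0^'] --> D (x, y).
Proof.
move=> h1; have [dx _ _ _ _] := f_regular unit_sphere_i h1.
have -> : (fun h => h^-1 *: (fi (h + x, y) - fi (x, y))) =
    (fun h => h^-1 *: ((fi \o shift (x, y)) (h *: (1, 0)) - fi (x, y))).
  by apply/funext => h; rewrite -shift_x.
exact: dx.
Qed.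

(** Multiplying the Cauchy-Riemann equation by i on the left expresses the partial derivative in y
    through [D]. *)
Let derive_y x y : qmod (slice_pt imag_i (x, y)) < 1 ->
  h^-1 *: (fi (x, h + y) - fi (x, y)) @[h --> 0^'] --> imag_i * D (x, y).
Proof.
move=> h1; have [_ dy _ _ CR] := f_regular unit_sphere_i h1.
have -> : imag_i * D (x, y) = 'D_(0, 1) fi (x, y).
  have : imag_i * (D (x, y) + imag_i * 'D_(0, 1) fi (x, y)) = 0.
    move/eqP: CR; rewrite scaler_eq0 invr_eq0 pnatr_eq0 /= => /eqP CR.
    by rewrite [X in imag_i * X]CR mulr0.
  rewrite mulrDr mulrA; have -> : imag_i * imag_i = -1 := unit_sphere_i.
  by rewrite mulN1r => /eqP; rewrite subr_eq0 => /eqP.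
have -> : (fun h => h^-1 *: (fi (x, h + y) - fi (x, y))) =
    (fun h => h^-1 *: ((fi \o shift (x, y)) (h *: (0, 1)) - fi (x, y))).
  by apply/funext => h; rewrite -shift_y.
exact: dy.
Qed.

(** Heine-Cantor on the closed disc of radius [s]; the second point may leave this disc. *)
Let D_unif_cont s e : s < 1 -> 0 < e -> exists2 d, 0 < d &
  forall x y x' y', qmod (slice_pt imag_i (x, y)) <= s ->
    `|x' - x| < d -> `|y' - y| < d -> qmod (D (x', y') - D (x, y)) <= e.
Proof.
move=> s1 e0.
pose K := [set p : R * R | qmod (slice_pt imag_i p) <= s].
have cK : compact K.
  apply: (@subclosed_compact _ _ (`[-1 : R, 1] `*` `[-1 : R, 1])).
  - apply: (@closed_comp _ _ (fun p : R * R => qmod (slice_pt imag_i p)) [set x : R | x <= s]) => [p _|].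
      exact: continuous_qmod_slice_pt.
    exact: closed_le.
  - by apply: compact_setX; exact: segment_compact.
  - move=> [x y] /= Kxy; rewrite /K /= in Kxy.
    have := le_trans (qcomp_le _ 0) Kxy; have := le_trans (qcomp_le _ 1) Kxy.
    rewrite slice_pt_i !qE !ler_norml => /andP[? ?] /andP[? ?].
    by split; rewrite /= in_itv /=; apply/andP; split; lra.
have hK : \forall d \near 0^'+, forall p : R * R, K p -> forall p' : R * R,
    `|p'.1 - p.1| < d -> `|p'.2 - p.2| < d -> qmod (D p' - D p) <= e.
  (* Near-covering form of compactness: half of the continuity radius goes to the neighbourhood of
     [p], the other half to the allowed displacement. *)
  move/compact_near_coveringP: cK => /(_ _ (0^'+) (fun (d : R) (p : R * R) => forall p' : R * R,
    `|p'.1 - p.1| < d -> `|p'.2 - p.2| < d -> qmod (D p' - D p) <= e)).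
  apply => p Kp.
  have [_ _ cD _ _] := f_regular unit_sphere_i (le_lt_trans Kp s1).
  have /qcvgP/(_ (e / 2) (divr_gt0 e0 (ltr0n _ 2))) := cD.
  move=> /nbhs_ballP[d /= d0 hd].
  exists (ball p (d / 2), [set t | t < d / 2]) => /=.
    split; first by apply: nbhsx_ballx; rewrite divr_gt0.
    by apply: nbhs_right_lt; rewrite divr_gt0.
  move=> [q t] [[/= q1 q2] td] p' p'1 p'2 /=.
  have h1 : qmod (D q - D p) < e / 2.
    by apply: hd; split => /=; [move: q1|move: q2]; apply: le_ball; lra.
  have h2 : qmod (D p' - D p) < e / 2.
    apply: hd; rewrite /ball /= in q1 q2.
    split; rewrite /ball /= distrC.
      have := ler_normD (p'.1 - q.1) (q.1 - p.1); rewrite subrKA [`|q.1 - _|]distrC; lra.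
    have := ler_normD (p'.2 - q.2) (q.2 - p.2); rewrite subrKA [`|q.2 - _|]distrC; lra.
  exact: qmod_dist_half h1 h2.
have [d [hd d0]] := filter_ex (filterI hK (nbhs_right_gt 0)).
by exists d => // x y x' y' h1 h2 h3; exact: (hd (x, y) h1 (x', y')).
Qed.

(** The path from [p] to [q] runs first along x, then along y. On each leg [D] stays within [e / 4]
    of its value at [p], so each leg contributes at most [e / 2 * qmod (q - p)]. *)
Lemma slice_regular_unif_derivable s : s < 1 -> unif_derivable f slice_partial_x s.
Proof.
move=> s1 e e0.
have [d d0 hd] := D_unif_cont s1 (divr_gt0 e0 (ltr0n _ 4)).
(* The bound [1 - s] keeps both legs of the path inside the unit ball. *)
exists (Num.min d (1 - s)); first by rewrite lt_min d0 subr_gt0.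
move=> p q pL qL ps qs; rewrite lt_min => /andP[pqd pqs].
rewrite /slice_partial_x -/fi -/D.
set x := qcomp p 0; set y := qcomp p 1; set x' := qcomp q 0; set y' := qcomp q 1.
have pE : p = slice_pt imag_i (x, y) by exact: in_sliceE.
have qE' : q = slice_pt imag_i (x', y') by exact: in_sliceE.
have qpE : q - p = (x' - x)%:A + (y' - y) *: imag_i.
  by rewrite pE qE' !slice_pt_i; apply: quatP; rewrite !qE; ring.
have xx : `|x' - x| <= qmod (q - p) by have := qcomp_le (q - p) 0; rewrite qcompD qcompN.
have yy : `|y' - y| <= qmod (q - p) by have := qcomp_le (q - p) 1; rewrite qcompD qcompN.
have in_ball a b : `|a - x| <= `|x' - x| -> `|b - y| <= `|y' - y| -> qmod (slice_pt imag_i (a, b)) < 1.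
  move=> ax by_; have -> : slice_pt imag_i (a, b) = p + mkquat (a - x) (b - y) 0 0.
    by rewrite pE !slice_pt_i; apply: quatP; rewrite !qE; ring.
  have : qmod (mkquat (a - x) (b - y) 0 0) <= qmod (q - p).
    rewrite qmod_le ?qmod_ge0// qmod_sqr qpE /qnorm2 !qE.
    have sq (u v : R) : `|u| <= `|v| -> u ^+ 2 <= v ^+ 2.
      by rewrite -[u ^+ 2]real_normK ?num_real// -[v ^+ 2]real_normK ?num_real// => ?; rewrite ler_sqr ?nnegrE.
    by have := sq _ _ ax; have := sq _ _ by_; rewrite !expr0n /=; lra.
  by have := qmodD p (mkquat (a - x) (b - y) 0 0); lra.
have hx : qmod (fi (x', y) - fi (x, y) - (x' - x) *: D (x, y)) <= 2 * (e / 4 * `|x' - x|).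
  apply: (@quat_increment_le_sym (fun t => fi (t, y)) (fun t => D (t, y))) => t tx; split.
    by apply: derive_x; apply: in_ball => //; rewrite subrr normr0.
  by apply: hd; rewrite -?pE// ?subrr ?normr0//; lra.
have hy : qmod (fi (x', y') - fi (x', y) - (y' - y) *: (imag_i * D (x, y))) <= 2 * (e / 4 * `|y' - y|).
  apply: (@quat_increment_le_sym (fun t => fi (x', t)) (fun t => imag_i * D (x', t))) => t ty; split.
    by apply: derive_y; apply: in_ball.
  by rewrite -mulrBr qmodM qmod_i mul1r; apply: hd; rewrite -?pE//; lra.
have -> : f q - f p - (q - p) * D (x, y) =
    (fi (x', y') - fi (x', y) - (y' - y) *: (imag_i * D (x, y)))
  + (fi (x', y) - fi (x, y) - (x' - x) *: D (x, y)).
  by rewrite qpE {1}qE' {1}pE; exact: split_increment.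
apply: (le_trans (qmodD _ _)); apply: (le_trans (lerD hy hx)).
by have := ler_wpM2l (ltW e0) xx; have := ler_wpM2l (ltW e0) yy; lra.
Qed.

Lemma slice_partial_x0 : slice_partial_x 0 = slice_derivative f 0.
Proof.
rewrite /slice_partial_x /slice_derivative !qcomp0 /derive.
have -> : (fun h : R => h^-1 *: ((slice_fun f imag_i \o shift (0, 0)) (h *: (1, 0))
    - slice_fun f imag_i (0, 0))) = (fun h => h^-1 *: ((f \o shift 0) (h *: 1) - f 0)).
  by apply/funext => h; rewrite /slice_fun /= shift_x !slice_pt_i mkquat_real mkquat0.
by [].
Qed.

End Regular.
End SliceRegularToUniform.

(** * Bloch's argument *)

Lemma qpower_sum_unique (R : realType) (c : nat -> quat R) (z p q : quat R) :
  qpower_sum c z p -> qpower_sum c z q -> p = q.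
Proof. exact: (@cvg_unique _ (@norm_hausdorff R (quat R))). Qed.

Lemma qpower_sum_coef0 (R : realType) (c : nat -> quat R) (z s a : quat R) :
  c 0%N = 0 -> qpower_sum c z s ->
  qpower_sum (fun n => if n is 0 then a else c n) z (s + a).
Proof.
move=> c0 /qcvgP cs; apply/qcvgP => e /cs; move=> [N _ hN].
exists N.+1 => // -[//|n] nN; have := hN n.+1 (ltnW nN).
rewrite /series /= !big_nat_recl//= c0 mulr0 add0r expr0 mul1r.
by rewrite [s + a]addrC opprD addrACA subrr add0r.
Qed.

(** The quantity (r - |z|) |G z| equals [r] at 0, so its supremum is at least [r]; [u] comes within
    one percent of this supremum, whether or not it is attained. *)
Lemma bloch_point (R : realType) (F G : quat R -> quat R) (r : R) :
  0 < r -> unif_derivable F G r -> G 0 = 1 ->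
  exists u, [/\ in_slice u, qmod u < r, 99 / 100 * r <= (r - qmod u) * qmod (G u) &
    forall z, in_slice z -> qmod z <= r ->
      (r - qmod z) * qmod (G z) <= 100 / 99 * ((r - qmod u) * qmod (G u))].
Proof.
move=> r0 FG G0; have [M GM] := unif_derivable_bounded (ltW r0) FG.
pose h (z : quat R) := (r - qmod z) * qmod (G z).
pose S := [set h z | z in [set z | in_slice z /\ qmod z <= r]].
have S0 : S r.
  by exists 0; [split; [exact: in_slice0|rewrite qmod0 ltW]|rewrite /h G0 qmod0 qmod1 subr0 mulr1].
have hS : has_sup S.
  split; first by exists r.
  exists (r * M) => _ [z [zL zr] <-].
  by apply: ler_pM; rewrite ?qmod_ge0 ?subr_ge0 ?GM// gerBl qmod_ge0.
have le_sup z : in_slice z -> qmod z <= r -> h z <= sup S.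
  by move=> zL zr; apply: sup_upper_bound => //; exists z.
have rS : r <= sup S by apply: sup_upper_bound.
have s0 : 0 < sup S / 100 by rewrite divr_gt0// (lt_le_trans r0).
have [_ [u [uL ur] <-] hu] := sup_adherent s0 hS.
have hu0 : 0 < h u by lra.
exists u; split=> //.
- rewrite lt_neqAle ur andbT; apply/eqP => ur'.
  by move: hu0; rewrite /h ur' subrr mul0r ltxx.
- by rewrite -/(h u); lra.
- by move=> z zL zr; rewrite -/(h u) -/(h z); have := le_sup z zL zr; lra.
Qed.

(** Bound |Re q| by |q| and cancel |q|^2, which is nonzero since 0 is not in [Oset rho]. *)
Lemma Oset_subset_ball (R : realType) (rho : R) (q : quat R) :
  0 <= rho -> Oset rho q -> qmod q <= rho.
Proof.
move=> rho0; rewrite /Oset /= => h.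
have q0 : 0 < qmod q.
  rewrite lt_neqAle qmod_ge0 andbT eq_sym; apply/eqP => q0.
  by move: h; rewrite (qmod_eq0 q0) qmod0 /qre qcomp0 normr0 !expr0n /= mulr0 ltxx.
rewrite -(ler_pM2r (exprn_gt0 2 q0)) -exprS (le_trans (ltW h))// ler_wpM2l//.
by rewrite ler_sqr ?nnegrE ?qmod_ge0//; exact: qcomp_le.
Qed.

Theorem theorem5p5 (R : realType) (f : quat R -> quat R)
  (f_regular : slice_regular 1 f)
  (f0 : f 0 = 0)
  (df0 : slice_derivative f 0 = 1) :
  exists (u : quat R) (ftilde : quat R -> quat R),
    [/\ qball 1 u,
        is_regular_translation 1 f u ftilde &
        exists (rho : R) (A : 'M[R]_4) (v : quat R),
          [/\ (32 * Num.sqrt 2)^-1 <= rho,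
              is_rotation A &
              [set rotate A q + v | q in Oset rho]
                `<=` ftilde @` qball (1 - qmod u)]].
Proof.
have [G [FG G0]] : exists G, (forall s, s < 1 -> unif_derivable f G s) /\ G 0 = 1.
  exists (slice_partial_x f); rewrite slice_partial_x0; split=> // s.
  exact: slice_regular_unif_derivable.
have r1 : 99 / 100 < 1 :> R by lra.
have r0 : 0 < 99 / 100 :> R by lra.
have [u [uL ur hu hmax]] := bloch_point r0 (FG _ r1) G0.
pose A := qmod (G u); pose s := 99 / 100 - qmod u; pose rho := s / 2.
have s0 : 0 < s by rewrite subr_gt0.
have rho0 : 0 < rho by rewrite divr_gt0.
have A0 : 0 < A.
  by rewrite lt_neqAle qmod_ge0 andbT eq_sym; apply/eqP => A0; move: hu; rewrite -/A A0 mulr0; lra.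
have rho1 : rho < 1 - qmod u by rewrite /rho /s; lra.
(* Subtracting [f u] makes [F] vanish at 0, so that it is bounded by its derivative alone; [c']
   restores the constant term later. *)
pose F z := f (z + u) - f u; pose G1 z := G (z + u).
have FG1 t : t < 1 - qmod u -> unif_derivable F G1 t.
  move=> t1; apply: (unif_derivable_shift (r := t + qmod u) uL (lexx _)).
  by apply: FG; rewrite -ltrBrDr.
have u1 : 0 < 1 - qmod u by lra.
have [c [c1 cb cF]] := slice_power_series_ball u1 (fun t _ => FG1 t).
rewrite /G1 add0r in c1.
have F0 : F 0 = 0 by rewrite /F add0r subrr.
(* For |z| <= rho the distance 99/100 - |z + u| is at least rho = s/2, so near-maximality gives |G
   (z + u)| <= 200/99 A <= 41/20 A. *)
have FM q : in_slice q -> qmod q <= rho -> qmod (F q) <= 41 / 20 * (A * rho).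
  move=> qL qr; apply: (@le_trans _ _ (41 / 20 * A * qmod q)); last first.
    by rewrite -mulrA ler_wpM2l// ler_wpM2l// ltW.
  rewrite -[F q]subr0 -F0 -[in leRHS](subr0 q).
  apply: (unif_derivable_lipschitz (FG1 _ rho1)) => //.
  - exact: in_slice0.
  - by rewrite qmod0 ltW.
  move=> z zL zr; have zu := qmodD z u.
  have zu1 : rho <= 99 / 100 - qmod (z + u).
    by move: zr zu; rewrite /rho /s; move: (qmod _) (qmod _) (qmod _) => a b d; clear; lra.
  have zu2 : qmod (z + u) <= 99 / 100 by rewrite -subr_ge0 (le_trans (ltW rho0)).
  rewrite -(ler_pM2l rho0); apply: (le_trans (ler_wpM2r (qmod_ge0 _) zu1)).
  apply: (le_trans (hmax _ (in_sliceD zL uL) zu2)).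
  by have := mulr_gt0 s0 A0; rewrite -/s -/A /rho; clear; move: s A => a b; lra.
have c0 : c 0%N = 0.
  rewrite -F0; apply: (psum_at0 rho0 (cb _ _ rho0 rho1 FM)).
  by apply: cF; rewrite ?qmod0//; exact: in_slice0.
pose c' n := if n is 0 then f u else c n.
(* The regular translation is the sum of the series on the whole ball of radius 1 - |u|, with
   default value 0 outside. *)
have /choice[g hg] : forall q, exists x, qmod q < 1 - qmod u -> qpower_sum c' q x.
  move=> q; have [q1|] := ltP (qmod q) (1 - qmod u); last by exists 0.
  pose t := (qmod q + (1 - qmod u)) / 2.
  have qt : qmod q < t by rewrite /t; lra.
  have t0 : 0 < t := le_lt_trans (qmod_ge0 q) qt.
  have t1 : t < 1 - qmod u by rewrite /t; lra.
  have [M FtM] := unif_derivable_fun_bounded (ltW t0) (FG1 _ t1).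
  have [x cx] := pseries_cvg t0 (cb _ _ t0 t1 FtM) qt.
  by exists (x + f u) => _; exact: qpower_sum_coef0.
exists u, g; split.
- by rewrite /qball /=; lra.
- exists (imag_i R), c'; split.
  + exact: unit_sphere_i.
  + exact/slice_iP.
  + move=> z [z1 /slice_iP zL]; rewrite -[f (z + u)](subrK (f u)).
    by apply: qpower_sum_coef0 => //; exact: cF.
  + by move=> q; exact: hg.
exists (32 * Num.sqrt 2)^-1, 1%:M, (f u); split=> //.
  by split; rewrite ?det1// trmx1 mulmx1.
move=> _ [y Oy <-]; rewrite /rotate mulmx1.
(* Numerically, 1/(32 sqrt 2) <= 5/224 < 0.0224, whereas the covered radius A rho / 20 = A s / 40 is
   at least (99/100)^2 / 40 > 0.0245. *)
have sqrt2 : 7 / 5 <= Num.sqrt 2 :> R.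
  by rewrite -(ler_sqr (x := 7 / 5)) ?nnegrE ?sqrtr_ge0// sqr_sqrtr//; lra.
have sqrt2' : (32 * Num.sqrt 2)^-1 <= 5 / 224 :> R.
  by rewrite -[leRHS]invrK lef_pV2 ?posrE ?invr_gt0 ?mulr_gt0//; lra.
have yb : qmod y <= qmod (c' 1%N) * rho / 20.
  have : qmod y <= (32 * Num.sqrt 2)^-1.
    by apply: Oset_subset_ball Oy; rewrite invr_ge0 mulr_ge0.
  by rewrite /c' c1 -/A /rho; move: hu; rewrite -/s -/A; lra.
have [||q qr cq] := @pseries_covering _ c' rho y rho0 _ _ yb.
- by rewrite /c' c1; apply/eqP => Gu; move: A0; rewrite /A Gu qmod0 ltxx.
- by move=> n; rewrite /c' /= c1; exact: cb FM _.
have q1 : qmod q < 1 - qmod u by apply: (le_lt_trans qr); lra.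
exists q => //; apply: (qpower_sum_unique (hg q q1)).
by rewrite addrC.
Qed.
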